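(* Let $\mathbb{F}$ be a field and $G$ a group. Let $[W_G]_{\mathrm{eq}}\in\mathrm{Irr}^{\mathrm{inv}}_{G,\mathbb{F}}$ and let $[\omega]\in H^2(G,\mathbb{F}^* )$. Then there exists $[\alpha]\in H^2(G,\mathbb{F}^* )$ such that $\omega_{G,\mathbb{F}}([\alpha(W_G)]_{\mathrm{eq}})=[\omega]$. In particular, the homomorphism $\omega_{G,\mathbb{F}}:\mathrm{Irr}^{\mathrm{inv}}_{G,\mathbb{F}}\to H^2(G,\mathbb{F}^* )$ is surjective.
   Context: Algebras are associative and unital. A $G$-graded $\mathbb{F}$-algebra is $A_G=\bigoplus_{g\in G}A_g$ with $A_gA_h\subseteq A_{gh}$; a $G$-graded left $A_G$-module is $W_G=\bigoplus_gW_g$ with $A_gW_h\subseteq W_{gh}$; $\stackrel{G}{\cong}$ denotes degree-preserving isomorphism. $\mathrm{End}^{\mathrm{r}(G)}_{A_G}(W_G)=\bigoplus_g\mathrm{End}^{\mathrm{r}(g)}_{A_G}(W_G)$, where $\mathrm{End}^{\mathrm{r}(g)}_{A_G}(W_G)$ is the set of $A_G$-endomorphisms mapping $W_h$ into $W_{hg}$ for all $h$; it acts from the right (product $\phi\psi$: first $\phi$, then $\psi$) and is a $G$-graded algebra. For $\alpha\in Z^2(G,\mathbb{F}^* )$ (trivial action), $\mathbb{F}^{\alpha}G=\bigoplus_g\mathbb{F}v_g$, $v_gv_h=\alpha(g,h)v_{gh}$; $\alpha(A_G)=\bigoplus_g\mathbb{F}v_g\otimes A_g\subseteq\mathbb{F}^{\alpha}G\otimes_{\mathbb{F}}A_G$,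 and $\alpha(W_G)=\bigoplus_g\mathbb{F}v_g\otimes W_g$ is a graded $\alpha(A_G)$-module by $(v_g\otimes a_g)(v_h\otimes w_h)=v_gv_h\otimes a_gw_h$. Graded left modules $W_G$ over $A_G$ and $W'_G$ over $A'_G$ are $G$-equivariant if there are a graded algebra isomorphism $\psi:A_G\to A'_G$ and a degree-preserving linear isomorphism $\varphi:W_G\to W'_G$ with $\varphi(xw)=\psi(x)\varphi(w)$; $[W_G]_{\mathrm{eq}}$ is the equivariance class. The suspension $h(W_G)$ is the same module regraded by $h(W_G)_g:=W_{gh}$; $W_G$ is $G$-invariant if $W_G\stackrel{G}{\cong}g(W_G)$ as graded $A_G$-modules for all $g\in G$. $W_G$ is absolutely $\mathbb{F}$-graded-simple if it is non-zero, has no proper non-zero graded submodules, and its degree-preserving $A_G$-endomorphisms are just $\mathbb{F}\cdot\mathrm{Id}$. $\mathrm{Irr}^{\mathrm{inv}}_{G,\mathbb{F}}$ is the set of equivariance classes of $G$-invariant absolutely $\mathbb{F}$-graded-simple left graded modules over $G$-graded $\mathbb{F}$-algebras (algebras and modules of cardinality bounded by fixed infinite cardinals, each at least $\max(|\mathbb{F}|,|G|)$). It is a monoid under $[W_G]_{\mathrm{eq}}\cdot[W'_G]_{\mathrm{eq}}=[\bigoplus_gW_g\otimes_{\mathbb{F}}W'_g]_{\mathrm{eq}}$ (graded product, a module over $\bigoplus_gA_g\otimes_{\mathbb{F}}A'_g$). The homomorphism $\omega_{G,\mathbb{F}}$ sends $[W_G]_{\mathrm{eq}}$ to the unique $[\beta]\in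 H^2(G,\mathbb{F}^* )$ with $\mathrm{End}^{\mathrm{r}(G)}_{A_G}(W_G)\stackrel{G}{\cong}\mathbb{F}^{\beta}G$. *)

(* Defs.v *)
From HB Require Import structures.
From mathcomp Require Import all_boot all_order all_algebra.
From mathcomp Require Import finmap boolp classical_sets functions.
From mathcomp Require Import generic_quotient monalg ring.

Set Implicit Arguments.
Unset Strict Implicit.
Unset Printing Implicit Defensive.

Import GRing.Theory.
Local Open Scope ring_scope.
Local Open Scope quotient_scope.

(* 2-cocycles for the trivial action are not assumed to be normalized, so the *)
(* unit of F^a G below is a(1,1)^-1 v_1.                                      *)
Section Cohomology.
Variables (F : fieldType) (G : groupType).

Record cocycle := Cocycle {
  cocycle_fun :> G -> G -> F;
  cocycle_neq0 : forall g h, cocycle_fun g h != 0;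
  cocycleE : forall g h k,
    cocycle_fun g h * cocycle_fun (g * h)%g k =
    cocycle_fun g (h * k)%g * cocycle_fun h k }.

HB.instance Definition _ := gen_eqMixin cocycle.
HB.instance Definition _ := gen_choiceMixin cocycle.

Fact trivial_cocycle_neq0 (g h : G) : (1 : F) != 0.
Proof. exact: oner_neq0. Qed.

Definition trivial_cocycle : cocycle :=
  @Cocycle (fun _ _ => 1) trivial_cocycle_neq0 (fun _ _ _ => erefl).

Definition cohomologous (a b : cocycle) : Prop :=
  exists2 c : G -> F, forall g, c g != 0 &
    forall g h, b g h = c g * c h * (c (g * h)%g)^-1 * a g h.

Definition cohomologousb (a b : cocycle) : bool := `[< cohomologous a b >].

Lemma cohomologousb_refl : reflexive cohomologousb.
Proof.
move=> a; apply/asboolP; exists (fun=> 1) => [g|g h]; first exact: oner_neq0.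
by rewrite invr1 !mul1r.
Qed.

Lemma cohomologous_sym a b : cohomologous a b -> cohomologous b a.
Proof.
move=> [c c0 cE]; exists (fun g => (c g)^-1) => [g|g h]; first by rewrite invr_eq0.
by rewrite cE; field; rewrite !c0 oner_neq0.
Qed.

Lemma cohomologousb_sym : symmetric cohomologousb.
Proof. by move=> a b; apply/asboolP/asboolP => /cohomologous_sym. Qed.

Lemma cohomologousb_trans : transitive cohomologousb.
Proof.
move=> b a d /asboolP[c c0 cE] /asboolP[e e0 eE]; apply/asboolP.
exists (fun g => e g * c g) => [g|g h]; first by rewrite mulf_neq0.
by rewrite eE cE; field; rewrite ?c0 ?e0 ?oner_neq0.
Qed.

Canonical cohomologous_equiv :=
  EquivRel cohomologousb cohomologousb_refl cohomologousb_sym cohomologousb_trans.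

Definition H2 : Type := {eq_quot cohomologousb}.
HB.instance Definition _ := Choice.on H2.
HB.instance Definition _ := EqQuotient.on H2.

Definition H2_class (a : cocycle) : H2 := \pi_H2 a.

Lemma H2_classP a b : H2_class a = H2_class b <-> cohomologous a b.
Proof.
rewrite /H2_class; split => [/eqmodP/asboolP //|ab].
by apply/eqmodP/asboolP.
Qed.

End Cohomology.

Section Gradings.
Variables (F : fieldType) (G : groupType).

(* V is the (internal) direct sum of the subspaces Vd g.                      *)
Definition is_grading (V : lmodType F) (Vd : G -> {pred V}) : Prop :=
  [/\ forall g, submod_closed (Vd g),
      forall v, exists (s : {fset G}) (c : G -> V),
        (forall g, c g \in Vd g) /\ v = \sum_(g <- s) c g
    & forall (s : {fset G}) (c : G -> V),
        (forall g, c g \in Vd g) -> \sum_(g <- s) c g = 0 ->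
        forall g, g \in s -> c g = 0].

Record gradedAlg := GradedAlg {
  galg :> algType F;
  gdeg : G -> {pred galg};
  gdeg_grading : is_grading gdeg;
  gdegM : forall g h x y,
    x \in gdeg g -> y \in gdeg h -> x * y \in gdeg (g * h)%g }.
#[global] Arguments gdeg : clear implicits.
#[global] Arguments gdeg A g : rename.
#[global] Arguments gdeg_grading A : rename.

(* The F-vector space underlying a module over an F-algebra.                  *)
Definition restr (A : algType F) (W : lmodType A) : Type := W.

Section Restr.
Variables (A : algType F) (W : lmodType A).
HB.instance Definition _ := GRing.Zmodule.copy (restr W) W.

Definition restr_scale (c : F) (w : restr W) : restr W := c%:A *: (w : W).

Fact restr_scaleA c d w :
  restr_scale c (restr_scale d w) = restr_scale (c * d) w.
Proof. by rewrite /restr_scale scalerA -scalerAl mul1r scalerA. Qed.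

Fact restr_scale1 : left_id 1 restr_scale.
Proof. by move=> w; rewrite /restr_scale !scale1r. Qed.

Fact restr_scaleDr : right_distributive restr_scale +%R.
Proof. by move=> c u v; rewrite /restr_scale scalerDr. Qed.

Fact restr_scaleDl w : {morph restr_scale^~ w : c d / c + d}.
Proof. by move=> c d; rewrite /restr_scale !scalerDl. Qed.

HB.instance Definition _ := GRing.Zmodule_isLmodule.Build F (restr W)
  restr_scaleA restr_scale1 restr_scaleDr restr_scaleDl.

Lemma restrZE (c : F) (w : restr W) : c *: w = (c%:A : A) *: (w : W).
Proof. by []. Qed.
End Restr.

Record gradedMod (A : gradedAlg) := GradedMod {
  gmod :> lmodType A;
  mdeg : G -> {pred restr gmod};
  mdeg_grading : is_grading mdeg;
  mdegM : forall g h (x : A) (w : gmod),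
    x \in gdeg A g -> w \in mdeg h -> x *: w \in mdeg (g * h)%g }.
#[global] Arguments mdeg {A} W g : rename.
#[global] Arguments mdeg_grading {A} W : rename.

Definition galg_iso (A B : gradedAlg) : Prop :=
  exists f : {lrmorphism A -> B},
    bijective f /\ forall g x, x \in gdeg A g -> f x \in gdeg B g.

Definition gmod_iso (A : gradedAlg) (W W' : gradedMod A) : Prop :=
  exists f : {linear W -> W'},
    bijective f /\ forall g w, w \in mdeg W g -> f w \in mdeg W' g.

Section Suspension.
Variables (A : gradedAlg) (W : gradedMod A) (k : G).

Definition susp_deg (g : G) : {pred restr W} := mdeg W (g * k)%g.

Fact susp_grading : is_grading susp_deg.
Proof.
have [sub span ind] := mdeg_grading W; split=> [g|v|s c cW].
- exact: sub.
- have [s [c [cW ->]]] := span v.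
  exists [fset (g * k^-1)%g | g in s]%fset, (fun g => c (g * k)%g).
  split=> [g|]; first exact: cW.
  rewrite big_imfset /= => [|g h _ _ /mulIg //].
  by apply: eq_bigr => g _; rewrite mulgVK.
- move=> s0 g gs; have := ind [fset (g * k)%g | g in s]%fset
    (fun g => c (g * k^-1)%g).
  move=> /(_ _ _ (g * k)%g); rewrite mulgK; apply => [h||].
  + by have := cW (h * k^-1)%g; rewrite /susp_deg mulgVK.
  + rewrite big_imfset /= => [|h h' _ _ /mulIg //].
    by rewrite -[RHS]s0; apply: eq_bigr => h _; rewrite mulgK.
  + by apply/imfsetP; exists g.
Qed.

Fact susp_degM g h (x : A) (w : W) :
  x \in gdeg A g -> w \in susp_deg h -> x *: w \in susp_deg (g * h)%g.
Proof. by move=> xg wh; rewrite /susp_deg -mulgA; exact: mdegM. Qed.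

Definition suspension : gradedMod A := GradedMod susp_grading susp_degM.
End Suspension.

Definition G_invariant (A : gradedAlg) (W : gradedMod A) : Prop :=
  forall g, gmod_iso W (suspension W g).

Definition graded_submod (A : gradedAlg) (W : gradedMod A) (N : {pred W}) :=
  submod_closed N /\
  forall w, w \in N -> exists (s : {fset G}) (c : G -> W),
    (forall g, c g \in N /\ c g \in mdeg W g) /\ w = \sum_(g <- s) c g.

Definition abs_graded_simple (A : gradedAlg) (W : gradedMod A) : Prop :=
  [/\ exists w : W, w != 0,
      forall N : {pred W}, graded_submod N ->
        (forall w, w \in N -> w = 0) \/ (forall w, w \in N)
    & forall f : {linear W -> W},
        (forall g w, w \in mdeg W g -> f w \in mdeg W g) ->
        exists c : F, forall w, f w = c%:A *: w].

Record gmodule := GModule { gm_alg : gradedAlg; gm_mod :> gradedMod gm_alg }.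

(* As psi fixes the scalars c%:A, the semilinearity of phi includes its       *)
(* F-linearity.                                                               *)
Definition equivariant (W W' : gmodule) : Prop :=
  exists (psi : {lrmorphism gm_alg W -> gm_alg W'})
         (phi : {linear W -> W' | psi \; *:%R}),
    [/\ bijective psi, forall g x, x \in gdeg (gm_alg W) g -> psi x \in gdeg (gm_alg W') g,
        bijective phi & forall g w, w \in mdeg W g -> phi w \in mdeg W' g].

End Gradings.

(* As the twisted group algebra F^a G is free on the v_g, the elements of     *)
(* F^a G (x) V are the sums of the v_g (x) x_g with (x_g) finitely supported  *)
(* in V; << x *g g >> stands for v_g (x) x.                                   *)
Definition tensG (F : fieldType) (G : groupType) (a : cocycle F G)
  (V : lmodType F) : Type := {malg V[G]}.

Section TensLmodule.
Variables (F : fieldType) (G : groupType) (a : cocycle F G) (V : lmodType F).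

HB.instance Definition _ := GRing.Zmodule.copy (tensG a V) {malg V[G]}.

Definition tensG_scale (c : F) (f : tensG a V) : tensG a V :=
  [malg g in msupp f => c *: f@_g].

Fact tensG_scaleE c (f : tensG a V) g : (tensG_scale c f)@_g = c *: f@_g.
Proof. by rewrite mcoeffE; case: msuppP; rewrite ?scaler0. Qed.

Fact tensG_scaleA c d f : tensG_scale c (tensG_scale d f) = tensG_scale (c * d) f.
Proof. by apply/malgP => g; rewrite !tensG_scaleE scalerA. Qed.

Fact tensG_scale1 : left_id 1 tensG_scale.
Proof. by move=> f; apply/malgP => g; rewrite tensG_scaleE scale1r. Qed.

Fact tensG_scaleDr : right_distributive tensG_scale +%R.
Proof.
by move=> c f f'; apply/malgP => g; rewrite mcoeffD !tensG_scaleE mcoeffD scalerDr.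
Qed.

Fact tensG_scaleDl f : {morph tensG_scale^~ f : c d / c + d}.
Proof.
by move=> c d; apply/malgP => g; rewrite mcoeffD !tensG_scaleE scalerDl.
Qed.

HB.instance Definition _ := GRing.Zmodule_isLmodule.Build F (tensG a V)
  tensG_scaleA tensG_scale1 tensG_scaleDr tensG_scaleDl.

Lemma mcoeffZ_tens c (f : tensG a V) g : (c *: f)@_g = c *: f@_g.
Proof. exact: tensG_scaleE. Qed.

Lemma msuppZ_tens c (f : tensG a V) : (msupp (c *: f) `<=` msupp f)%fset.
Proof.
apply/fsubsetP => g; rewrite -!mcoeff_neq0 mcoeffZ_tens.
by apply/contra_neq => ->; rewrite scaler0.
Qed.

Lemma scale_tensU c x (g : G) :
  c *: (<< x *g g >> : tensG a V) = << c *: x *g g >>.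
Proof.
by apply/malgP => h; rewrite mcoeffZ_tens !mcoeffU; case: eqP;
   rewrite ?mulr1n ?mulr0n ?scaler0.
Qed.
End TensLmodule.

(* The product (v_g (x) x) (v_h (x) y) = a(g,h) v_gh (x) op x y.              *)
Definition tconv (F : fieldType) (G : groupType) (a : cocycle F G)
    (U V W : lmodType F) (op : U -> V -> W) (f : tensG a U) (k : tensG a V) :
    tensG a W :=
  \sum_(g <- msupp f) \sum_(h <- msupp k)
     << a g h *: op f@_g k@_h *g (g * h)%g >>.

Section Tconv.
Variables (F : fieldType) (G : groupType) (a : cocycle F G).

Section Bilinear.
Variables (U V W : lmodType F) (op : U -> V -> W).
Hypothesis opDl : forall x x' y, op (x + x') y = op x y + op x' y.
Hypothesis opDr : forall x y y', op x (y + y') = op x y + op x y'.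
Local Notation conv := (@tconv F G a U V W op).

Let op0l y : op 0 y = 0.
Proof. by apply: (addrI (op 0 y)); rewrite -opDl !addr0. Qed.

Let op0r x : op x 0 = 0.
Proof. by apply: (addrI (op x 0)); rewrite -opDr !addr0. Qed.

Lemma tconvEw (d e : {fset G}) f k : (msupp f `<=` d)%fset ->
  (msupp k `<=` e)%fset -> conv f k =
  \sum_(g <- d) \sum_(h <- e) << a g h *: op f@_g k@_h *g (g * h)%g >>.
Proof.
move=> fd ke; rewrite /tconv; rewrite (big_fset_incl _ fd) /= => [|g _ gf].
  apply: eq_bigr => g _; rewrite (big_fset_incl _ ke) //= => h _ hk.
  by rewrite (mcoeff_outdom hk) op0r scaler0 monalgU0.
by rewrite big1 // => h _; rewrite (mcoeff_outdom gf) op0l scaler0 monalgU0.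
Qed.

Lemma tconvDl f f' k : conv (f + f') k = conv f k + conv f' k.
Proof.
rewrite (tconvEw (msuppD_le f f') (fsubset_refl _)).
rewrite (tconvEw (fsubsetUl (msupp f) (msupp f')) (fsubset_refl (msupp k))).
rewrite (tconvEw (fsubsetUr (msupp f) (msupp f')) (fsubset_refl (msupp k))).
rewrite -big_split /=; apply: eq_bigr => g _.
rewrite -big_split /=; apply: eq_bigr => h _.
by rewrite mcoeffD opDl scalerDr monalgUD.
Qed.

Lemma tconvDr f k k' : conv f (k + k') = conv f k + conv f k'.
Proof.
rewrite (tconvEw (fsubset_refl _) (msuppD_le k k')).
rewrite (tconvEw (fsubset_refl (msupp f)) (fsubsetUl (msupp k) (msupp k'))).
rewrite (tconvEw (fsubset_refl (msupp f)) (fsubsetUr (msupp k) (msupp k'))).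
rewrite -big_split /=; apply: eq_bigr => g _.
rewrite -big_split /=; apply: eq_bigr => h _.
by rewrite mcoeffD opDr scalerDr monalgUD.
Qed.

Lemma tconv0l k : conv 0 k = 0.
Proof. by rewrite /tconv msupp0 big_seq_fset0. Qed.

Lemma tconv0r f : conv f 0 = 0.
Proof. by rewrite /tconv big1 // => g _; rewrite msupp0 big_seq_fset0. Qed.

Lemma tconvUU x (g : G) y (h : G) :
  conv << x *g g >> << y *g h >> = << a g h *: op x y *g (g * h)%g >>.
Proof.
by rewrite (tconvEw msuppU_le msuppU_le) !big_seq_fset1 !mcoeffUU.
Qed.

Lemma tconv_suml (I : Type) (r : seq I) (P : pred I) E k :
  conv (\sum_(i <- r | P i) E i) k = \sum_(i <- r | P i) conv (E i) k.
Proof.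
exact: (big_morph (fun f => conv f k) (fun f f' => tconvDl f f' k) (tconv0l k)).
Qed.

Lemma tconv_sumr (I : Type) (r : seq I) (P : pred I) E f :
  conv f (\sum_(i <- r | P i) E i) = \sum_(i <- r | P i) conv f (E i).
Proof. exact: (big_morph (conv f) (tconvDr f) (tconv0r f)). Qed.

Lemma tconv_ind (P : tensG a W -> Prop) f k : P 0 ->
  (forall u v, P u -> P v -> P (u + v)) ->
  (forall g h, P << a g h *: op f@_g k@_h *g (g * h)%g >>) -> P (conv f k).
Proof.
move=> P0 PD PU; rewrite /tconv; apply: (big_ind P) => // g _.
exact: (big_ind P).
Qed.

Lemma tconvZl c f k : (forall c x y, op (c *: x) y = c *: op x y) ->
  conv (c *: f) k = c *: conv f k.
Proof.
move=> opZ; rewrite (tconvEw (msuppZ_tens c f) (fsubset_refl _)) scaler_sumr.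
apply: eq_bigr => g _; rewrite scaler_sumr; apply: eq_bigr => h _.
by rewrite scale_tensU mcoeffZ_tens opZ !scalerA mulrC.
Qed.

Lemma tconvZr c f k : (forall c x y, op x (c *: y) = c *: op x y) ->
  conv f (c *: k) = c *: conv f k.
Proof.
move=> opZ; rewrite (tconvEw (fsubset_refl _) (msuppZ_tens c k)) scaler_sumr.
apply: eq_bigr => g _; rewrite scaler_sumr; apply: eq_bigr => h _.
by rewrite scale_tensU mcoeffZ_tens opZ !scalerA mulrC.
Qed.
End Bilinear.

Lemma tconvA (U V W UV VW T : lmodType F) (op1 : U -> V -> UV)
    (op2 : UV -> W -> T) (op3 : V -> W -> VW) (op4 : U -> VW -> T)
    (D1l : forall x x' y, op1 (x + x') y = op1 x y + op1 x' y)
    (D1r : forall x y y', op1 x (y + y') = op1 x y + op1 x y')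
    (D2l : forall x x' y, op2 (x + x') y = op2 x y + op2 x' y)
    (D2r : forall x y y', op2 x (y + y') = op2 x y + op2 x y')
    (D3l : forall x x' y, op3 (x + x') y = op3 x y + op3 x' y)
    (D3r : forall x y y', op3 x (y + y') = op3 x y + op3 x y')
    (D4l : forall x x' y, op4 (x + x') y = op4 x y + op4 x' y)
    (D4r : forall x y y', op4 x (y + y') = op4 x y + op4 x y')
    (Z2 : forall c x y, op2 (c *: x) y = c *: op2 x y)
    (Z4 : forall c x y, op4 x (c *: y) = c *: op4 x y)
    (opA : forall x y z, op2 (op1 x y) z = op4 x (op3 y z))
    (f : tensG a U) (k : tensG a V) (l : tensG a W) :
  tconv op2 (tconv op1 f k) l = tconv op4 f (tconv op3 k l).
Proof.
rewrite [f]monalgE [k]monalgE [l]monalgE.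
rewrite (tconv_suml D1l D1r) (tconv_suml D2l D2r) (tconv_suml D4l D4r).
apply: eq_bigr => g _.
rewrite (tconv_sumr D1l D1r) (tconv_suml D2l D2r) (tconv_suml D3l D3r) (tconv_sumr D4l D4r).
apply: eq_bigr => h _.
rewrite (tconv_sumr D2l D2r) (tconv_sumr D3l D3r) (tconv_sumr D4l D4r).
apply: eq_bigr => m _.
rewrite (tconvUU D1l D1r) (tconvUU D2l D2r) (tconvUU D3l D3r) (tconvUU D4l D4r).
by rewrite Z2 Z4 !scalerA opA mulgA mulrC cocycleE mulrC.
Qed.
End Tconv.

Section TensAlgebra.
Variables (F : fieldType) (G : groupType) (a : cocycle F G) (A : algType F).

Lemma cocycle1g g : a 1%g g = a 1%g 1%g.
Proof.
by have := cocycleE a 1%g 1%g g; rewrite !mul1g => /(mulIf (cocycle_neq0 _ _ _)).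
Qed.

Lemma cocycleg1 g : a g 1%g = a 1%g 1%g.
Proof.
by have := cocycleE a g 1%g 1%g; rewrite !mulg1 => /(mulfI (cocycle_neq0 _ _ _)).
Qed.

Definition tens_mul (f k : tensG a A) : tensG a A := tconv *%R f k.

Definition tens_one : tensG a A := << (a 1%g 1%g)^-1 *: 1 *g 1%g >>.

Let mDl (x y z : A) : (x + y) * z = x * z + y * z. Proof. exact: mulrDl. Qed.
Let mDr (x y z : A) : x * (y + z) = x * y + x * z. Proof. exact: mulrDr. Qed.

Fact tens_mulA : associative tens_mul.
Proof.
move=> f k l; rewrite /tens_mul; apply/esym/tconvA => //.
- by move=> c x y; rewrite scalerAl.
- by move=> c x y; rewrite scalerAr.
- by move=> x y z; rewrite mulrA.
Qed.

Fact tens_mul1 : left_id tens_one tens_mul.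
Proof.
move=> f; rewrite /tens_mul [X in tconv _ _ X]monalgE (tconv_sumr mDl mDr).
rewrite [RHS]monalgE; apply: eq_bigr => g _.
rewrite (tconvUU _ mDl mDr) mul1g cocycle1g -scalerAl mul1r scalerA.
by rewrite mulfV ?cocycle_neq0 // scale1r.
Qed.

Fact tens_1mul : right_id tens_one tens_mul.
Proof.
move=> f; rewrite /tens_mul [X in tconv _ X _]monalgE (tconv_suml mDl mDr).
rewrite [RHS]monalgE; apply: eq_bigr => g _.
rewrite (tconvUU _ mDl mDr) mulg1 cocycleg1 -scalerAr mulr1 scalerA.
by rewrite mulfV ?cocycle_neq0 // scale1r.
Qed.

Fact tens_mulDl : left_distributive tens_mul +%R.
Proof. by move=> f f' k; exact: tconvDl. Qed.

Fact tens_mulDr : right_distributive tens_mul +%R.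
Proof. by move=> f k k'; exact: tconvDr. Qed.

Fact tens_one_neq0 : tens_one != 0.
Proof.
by rewrite monalgU_eq0 scaler_eq0 invr_eq0 (negbTE (cocycle_neq0 _ _ _)) oner_eq0.
Qed.

HB.instance Definition _ := GRing.Zmodule_isNzRing.Build (tensG a A)
  tens_mulA tens_mul1 tens_1mul tens_mulDl tens_mulDr tens_one_neq0.

Fact tens_scaleAl (c : F) (f k : tensG a A) : c *: (f * k) = (c *: f) * k.
Proof. by apply/esym/(tconvZl mDl mDr) => d x y; rewrite scalerAl. Qed.

Fact tens_scaleAr (c : F) (f k : tensG a A) : c *: (f * k) = f * (c *: k).
Proof. by apply/esym/(tconvZr mDl mDr) => d x y; rewrite scalerAr. Qed.

HB.instance Definition _ := GRing.Lmodule_isLalgebra.Build F (tensG a A) tens_scaleAl.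
HB.instance Definition _ := GRing.Lalgebra_isAlgebra.Build F (tensG a A) tens_scaleAr.

Lemma tensMUU x (g : G) y (h : G) :
  (<< x *g g >> : tensG a A) * << y *g h >> = << a g h *: (x * y) *g (g * h)%g >>.
Proof. exact: (tconvUU _ mDl mDr). Qed.
End TensAlgebra.

(* tens exhibits tensG a V as the tensor product of F^a G = tensG a F^o and V *)
(* (tensG_universal), with the product of F^a G (x) A when V is an algebra A  *)
(* (tensM).                                                                   *)
Section TensUniversal.
Variables (F : fieldType) (G : groupType) (a : cocycle F G) (V : lmodType F).

Definition tens (x : tensG a F^o) (v : V) : tensG a V :=
  \sum_(g <- msupp x) << x@_g *: v *g g >>.

Lemma tensE x v g : (tens x v)@_g = x@_g *: v.
Proof.
rewrite /tens raddf_sum /=; under eq_bigr do rewrite mcoeffU.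
case: (boolP (g \in msupp x)) => [gx|gx].
  rewrite (big_fsetD1 g) //= eqxx big1_fset ?addr0 // => h.
  by rewrite in_fsetD1 => /andP[/negbTE ->].
rewrite (mcoeff_outdom gx) scale0r big1_seq // => h /= hx.
by case: eqP hx gx => [->|//] ->.
Qed.

Lemma msupp_tens x v : (msupp (tens x v) `<=` msupp x)%fset.
Proof.
apply/fsubsetP => g; rewrite -!mcoeff_neq0 tensE.
by apply/contra_neq => ->; rewrite scale0r.
Qed.

Lemma tensG_universal (T : lmodType F) (b : tensG a F^o -> V -> T) :
  (forall v, linear (b^~ v)) -> (forall x, linear (b x)) ->
  exists! f : tensG a V -> T, linear f /\ forall x v, f (tens x v) = b x v.
Proof.
move=> bl br.
pose bl' v := GRing.isLinear.Build _ _ _ _ (b^~ v) (bl v).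
pose Bl v : {linear tensG a F^o -> T} := HB.pack (b^~ v) (bl' v).
pose br' x := GRing.isLinear.Build _ _ _ _ (b x) (br x).
pose Br x : {linear V -> T} := HB.pack (b x) (br' x).
pose e g : tensG a F^o := << 1 *g g >>.
pose f (u : tensG a V) := \sum_(g <- msupp u) Br (e g) u@_g.
have fw (u : tensG a V) (d : {fset G}) : (msupp u `<=` d)%fset ->
    f u = \sum_(g <- d) Br (e g) u@_g.
  move=> ud; rewrite /f (big_fset_incl _ ud) //= => g _ gu.
  by rewrite (mcoeff_outdom gu); exact: (raddf0 (Br (e g))).
exists f; split; [split|].
- move=> c u v; pose d := (msupp u `|` msupp v)%fset.
  rewrite (fw u d) ?fsubsetUl // (fw v d) ?fsubsetUr // (fw _ d); last first.
    apply: fsubset_trans (msuppD_le _ _) _.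
    exact: fsetUSS (msuppZ_tens c u) (fsubset_refl _).
  rewrite scaler_sumr -big_split /=; apply: eq_bigr => g _.
  by rewrite mcoeffD mcoeffZ_tens; exact: (linearP (Br (e g))).
- move=> x v; rewrite (fw _ _ (msupp_tens x v)) [in RHS](monalgE x).
  rewrite -[RHS]/(Bl v _) (raddf_sum (Bl v)); apply: eq_bigr => g _.
  rewrite tensE; apply: (etrans (linearZZ (Br (e g)) _ _)).
  apply: (etrans (esym (linearZZ (Bl v) x@_g (e g)))); congr (Bl v _).
  rewrite /e (scale_tensU a); congr (<< _ *g g >>); exact: mulr1.
- move=> f' [f'l f'E].
  pose f'l' := GRing.isLinear.Build _ _ _ _ f' f'l.
  pose FF : {linear tensG a V -> T} := HB.pack f' f'l'.
  apply/funext => u; rewrite [in RHS](monalgE u) -[RHS]/(FF _) (raddf_sum FF).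
  apply: eq_bigr => g _; rewrite /= -f'E; congr (f' _).
  apply/malgP => h; rewrite tensE !mcoeffU.
  by case: eqP => _; rewrite ?mulr1n ?mulr0n ?scale1r ?scale0r.
Qed.
End TensUniversal.

Lemma tensM (F : fieldType) (G : groupType) (a : cocycle F G) (A : algType F)
    (x y : tensG a F^o) (u v : A) :
  tens x u * tens y v = tens (x * y) (u * v).
Proof.
move: (tensE x u) (msupp_tens x u) (tensE y v) (msupp_tens y v).
move: (tens x u) (tens y v) => t t' tE ts t'E t's.
apply/malgP => k; rewrite tensE -[x * y]/(tconv _ x y) /tconv.
rewrite -[X in X@_k = _]/(tconv _ t t').
rewrite (tconvEw _ (fun p q r : A => mulrDl p q r)
  (fun p q r : A => mulrDr p q r) ts t's).
rewrite !raddf_sum scaler_suml; apply: eq_bigr => g _.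
rewrite !raddf_sum scaler_suml; apply: eq_bigr => h _ /=.
rewrite !mcoeffU tE t'E; case: eqP => _; rewrite ?mulr1n ?mulr0n ?scale0r //.
rewrite -scalerAl -scalerAr !scalerA; congr (_ *: _); exact/esym/mulrA.
Qed.

Section GradingTheory.
Variables (F : fieldType) (G : groupType).

Lemma grading_indep (V : lmodType F) (Vd : G -> {pred V}) (r r' : G -> G)
    (s : {fset G}) (c : G -> V) :
  is_grading Vd -> cancel r r' -> cancel r' r ->
  (forall g, c g \in Vd (r g)) -> \sum_(g <- s) c g = 0 ->
  forall g, g \in s -> c g = 0.
Proof.
move=> [_ _ ind] rK r'K cV s0 g gs.
have := ind [fset r g | g in s]%fset (c \o r'); rewrite /comp.
move=> /(_ _ _ (r g)); rewrite rK; apply => [h||].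
- by rewrite -{2}[h]r'K.
- rewrite big_imfset /= => [|h h' _ _ /(can_inj rK) //].
  by rewrite -[RHS]s0; apply: eq_bigr => h _; rewrite rK.
- by apply/imfsetP; exists g.
Qed.

Lemma gdeg1 (A : gradedAlg F G) : 1 \in gdeg A 1%g.
Proof.
have [sub span _] := gdeg_grading A.
have [s [c [cA e1]]] := span 1.
pose c' g := if g \in s then c g else 0.
have c'A g : c' g \in gdeg A g.
  by rewrite /c'; case: ifP => // _; case: (sub g).
have e1' : 1 = \sum_(g <- (s `|` [fset 1%g])%fset) c' g.
  rewrite e1 -(big_fset_incl _ (fsubsetUl s [fset 1%g]%fset)) /=; last first.
    by move=> g _ gs; rewrite /c' (negbTE gs).
  by apply: eq_big_seq => g gs; rewrite /c' gs.
have key h x : x \in gdeg A h -> c' 1%g * x = x.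
  move=> xh; apply/eqP; rewrite -subr_eq0; apply/eqP.
  pose d g := c' g * x - (if g == 1%g then x else 0).
  have <- : d 1%g = c' 1%g * x - x by rewrite /d eqxx.
  apply: (@grading_indep A (gdeg A) (fun g => (g * h)%g)
    (fun g => (g * h^-1)%g) (s `|` [fset 1%g])%fset d (gdeg_grading A)).
  - by move=> g; rewrite mulgK.
  - by move=> g; rewrite mulgVK.
  - move=> g; rewrite /d; have [s0 sl] := sub (g * h)%g.
    rewrite addrC -[in X in X + _](mulr1 (if _ then _ else _)).
    have -> : - ((if g == 1%g then x else 0) * 1) =
        (-1 : F) *: (if g == 1%g then x else 0) by rewrite mulr1 scaleN1r.
    apply: sl; last exact: gdegM.
    by case: eqP => // ->; rewrite mul1g.
  - rewrite sumrB -mulr_suml -e1' mul1r (big_fsetD1 1%g) ?inE ?eqxx ?orbT //=.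
    rewrite big1_fset ?addr0 ?subrr // => g.
    by rewrite in_fsetD1 => /andP[/negbTE ->].
  - by rewrite !inE eqxx orbT.
suff <- : c' 1%g = 1 by exact: c'A.
rewrite -[c' 1%g]mulr1 [in LHS]e1 [RHS]e1 mulr_sumr.
by apply: eq_bigr => g _; exact: key (cA g).
Qed.
End GradingTheory.

(* The direct sum of the F v_g (x) V_g inside F^a G (x) V. The grading        *)
(* hypothesis is a parameter so that diag is inferred to be a submodule.      *)
Section Diagonal.
Variables (F : fieldType) (G : groupType) (a : cocycle F G).
Variables (V : lmodType F) (Vd : G -> {pred V}) (grV : is_grading Vd).

Definition diag (_ : is_grading Vd) : {pred tensG a V} :=
  fun f => all (fun g => f@_g \in Vd g) (msupp f).

Lemma diagP f : reflect (forall g, f@_g \in Vd g) (f \in diag grV).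
Proof.
apply: (iffP allP) => [H g|H g _]; last exact: H.
have [_ _] := grV => _; have [V0 _] : submod_closed (Vd g) by case: grV.
by case: (boolP (g \in msupp f)) => [/H //|/mcoeff_outdom ->].
Qed.

Fact diag_submod_closed : submod_closed (diag grV).
Proof.
have sub g : submod_closed (Vd g) by case: grV.
split=> [|c f k /diagP fd /diagP kd].
  by apply/diagP => g; rewrite mcoeff0; case: (sub g).
apply/diagP => g; rewrite mcoeffD mcoeffZ_tens.
by case: (sub g) => _; apply.
Qed.

HB.instance Definition _ :=
  GRing.isSubmodClosed.Build F (tensG a V) (diag grV) diag_submod_closed.

Record diag_type := Diag { diag_val : tensG a V; _ : diag_val \in diag grV }.

HB.instance Definition _ := [isSub for diag_val].
HB.instance Definition _ := [Choice of diag_type by <:].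
HB.instance Definition _ := [SubChoice_isSubLmodule of diag_type by <:].

Lemma diag_val0 g : (val (0 : diag_type))@_g = 0.
Proof. by rewrite (raddf0 (val : diag_type -> tensG a V)) mcoeff0. Qed.

Lemma diag_valP c (f k : diag_type) g :
  (val (c *: f + k))@_g = c *: (val f)@_g + (val k)@_g.
Proof.
rewrite (linearP (val : diag_type -> tensG a V)).
by rewrite mcoeffD mcoeffZ_tens.
Qed.

Lemma diag_val_sum (s : seq G) (c : G -> diag_type) g :
  (val (\sum_(h <- s) c h))@_g = \sum_(h <- s) (val (c h))@_g.
Proof.
by rewrite (raddf_sum (val : diag_type -> tensG a V)) raddf_sum.
Qed.

Definition diag_deg (g : G) : {pred diag_type} :=
  fun f => (msupp (val f) `<=` [fset g])%fset.

Lemma diag_degP g f :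
  reflect (forall h, h != g -> (val f)@_h = 0) (f \in diag_deg g).
Proof.
have -> : (f \in diag_deg g) = (msupp (val f) `<=` [fset g])%fset by [].
apply: (iffP idP) => [/fsubsetP H h hg|H].
  by apply/mcoeff_outdom/negP => /H; rewrite inE (negbTE hg).
by apply/fsubsetP => h; rewrite inE -mcoeff_neq0; apply: contraNT => /H ->.
Qed.

Lemma diagU_subproof (f : diag_type) g :
  << (val f)@_g *g g >> \in diag grV.
Proof.
have fd := diagP _ (valP f); apply/diagP => h; rewrite mcoeffU.
case: eqP => [<-|_]; first by rewrite mulr1n; exact: fd.
rewrite mulr0n.
by have [] : submod_closed (Vd h) by case: grV.
Qed.

Lemma diag_grading : is_grading diag_deg.
Proof.
split=> [g|f|s c cd s0 g gs].
- split=> [|c f k /diag_degP fg /diag_degP kg].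
    by apply/diag_degP => h _; exact: diag_val0.
  apply/diag_degP => h hg.
  by rewrite diag_valP fg // kg // scaler0 addr0.
- exists (msupp (val f)), (fun g => Diag (diagU_subproof f g)); split=> [g|].
    by apply/diag_degP => h hg; rewrite mcoeffU eq_sym (negbTE hg) mulr0n.
  apply: val_inj; rewrite (raddf_sum (val : diag_type -> tensG a V)).
  exact: monalgE.
- apply: val_inj; apply/malgP => h; rewrite diag_val0.
  have [->|hg] := eqVneq h g; last by move/diag_degP: (cd g) => ->.
  have := congr1 (fun f : diag_type => (val f)@_g) s0.
  rewrite /= diag_val0 diag_val_sum (big_fsetD1 g) //=.
  rewrite big1_fset ?addr0 // => k; rewrite in_fsetD1 => /andP[kg _] _.
  by move/diag_degP: (cd k) => ->; rewrite // eq_sym.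
Qed.
End Diagonal.
#[global] Arguments diag {F G} a {V Vd}.
#[global] Arguments diag_type {F G} a {V Vd}.
#[global] Arguments diag_grading {F G} a {V Vd}.

Section AlphaAlgebra.
Variables (F : fieldType) (G : groupType) (a : cocycle F G) (A : gradedAlg F G).

Definition alpha_alg_type : Type := diag_type a (gdeg_grading A).
Local Notation alphaA := alpha_alg_type.

HB.instance Definition _ :=
  GRing.SubLmodule.copy alphaA (diag_type a (gdeg_grading A)).

Fact diag_mulr_closed : GRing.mulr_closed (diag a (gdeg_grading A)).
Proof.
have sub g : submod_closed (gdeg A g) by case: (gdeg_grading A).
have subU g x : x \in gdeg A g -> << x *g g >> \in diag a (gdeg_grading A).
  move=> xg; apply/diagP => h; rewrite mcoeffU.
  case: eqP => [<-|_]; first by rewrite mulr1n.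
  by rewrite mulr0n; case: (sub h).
split=> [|f k /diagP fd /diagP kd].
  apply: subU; rewrite -[X in X \in _]addr0.
  by case: (sub 1%g) => A0 AZ; apply: AZ; rewrite ?gdeg1.
apply: (@tconv_ind _ _ _ _ _ _ *%R (fun f => f \in diag a (gdeg_grading A))).
- exact: rpred0.
- by move=> u v; exact: rpredD.
- move=> g h; apply: subU; rewrite -[X in X \in _]addr0.
  by case: (sub (g * h)%g) => A0 AZ; apply: AZ => //; exact: gdegM.
Qed.

HB.instance Definition _ := GRing.isMulClosed.Build (tensG a A)
  (diag a (gdeg_grading A)) diag_mulr_closed.

HB.instance Definition _ :=
  [SubZmodule_isSubNzRing of alphaA by <:].
HB.instance Definition _ :=
  [SubNzRing_SubLmodule_isSubLalgebra of alphaA by <:].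
HB.instance Definition _ := [SubLalgebra_isSubAlgebra of alphaA by <:].

Fact alpha_degM g h (x y : alphaA) :
  (x : diag_type _ _) \in diag_deg g -> (y : diag_type _ _) \in diag_deg h ->
  (x * y : diag_type _ _) \in diag_deg (g * h)%g.
Proof.
move=> xg yh; rewrite /diag_deg unfold_in.
have -> : val (x * y) = tconv *%R (val x) (val y) by [].
rewrite (tconvEw _ (fun p q r : A => mulrDl p q r)
  (fun p q r : A => mulrDr p q r) xg yh) !big_seq_fset1.
exact: msuppU_le.
Qed.

Definition alpha_alg : gradedAlg F G :=
  @GradedAlg F G alphaA _ (diag_grading a (gdeg_grading A)) alpha_degM.
End AlphaAlgebra.

Section AlphaModule.
Variables (F : fieldType) (G : groupType) (a : cocycle F G) (A : gradedAlg F G).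
Variable W : gradedMod A.

Definition alpha_mod_type : Type := diag_type a (mdeg_grading W).
HB.instance Definition _ :=
  GRing.Zmodule.copy alpha_mod_type (diag_type a (mdeg_grading W)).

Definition act_op (x : A) (w : restr W) : restr W := x *: (w : W).

Let actDl x y w : act_op (x + y) w = act_op x w + act_op y w.
Proof. exact: (scalerDl (w : W) x y). Qed.

Let actDr x v w : act_op x (v + w) = act_op x v + act_op x w.
Proof. exact: (scalerDr x (v : W) w). Qed.

Let actZl c x w : act_op (c *: x) w = c *: act_op x w.
Proof. by rewrite restrZE /act_op scalerA -scalerAl mul1r. Qed.

Let actZr c x w : act_op x (c *: w) = c *: act_op x w.
Proof. by rewrite !restrZE /act_op !scalerA -scalerAl -scalerAr mulr1 mul1r. Qed.

Fact alpha_act_subproof (x : alpha_alg_type a A) (w : alpha_mod_type) :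
  tconv act_op (diag_val x) (diag_val w) \in diag a (mdeg_grading W).
Proof.
have sub g : submod_closed (mdeg W g) by case: (mdeg_grading W).
have xd : diag_val x \in diag a (gdeg_grading A) by case: (x).
have wd : diag_val w \in diag a (mdeg_grading W) by case: (w).
move/diagP: xd => xd; move/diagP: wd => wd.
apply: (@tconv_ind _ _ _ _ _ _ _ (fun f => f \in diag a (mdeg_grading W))).
- exact: rpred0.
- by move=> u v; exact: rpredD.
- move=> g h; apply/diagP => k; rewrite mcoeffU.
  case: eqP => [<-|_]; last by rewrite mulr0n; case: (sub k).
  rewrite mulr1n -[X in X \in _]addr0.
  case: (sub (g * h)%g) => W0 WZ; apply: WZ => //; exact: mdegM.
Qed.

(* (v_g (x) x_g) (v_h (x) w_h) = v_g v_h (x) x_g w_h.                         *)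
Definition alpha_act (x : alpha_alg a A) (w : alpha_mod_type) : alpha_mod_type :=
  Diag (alpha_act_subproof x w).

Fact alpha_actA x y w : alpha_act x (alpha_act y w) = alpha_act (x * y) w.
Proof.
apply: val_inj; apply/esym/tconvA => //.
- by move=> *; rewrite mulrDl.
- by move=> *; rewrite mulrDr.
- by move=> *; rewrite /act_op scalerA.
Qed.

Fact alpha_act1 : left_id 1 alpha_act.
Proof.
move=> w; apply: val_inj.
change (tconv act_op (tens_one a A) (diag_val w) = diag_val w).
rewrite [X in tconv _ _ X]monalgE (tconv_sumr actDl actDr).
rewrite [RHS]monalgE; apply: eq_bigr => g _.
rewrite (tconvUU _ actDl actDr) mul1g cocycle1g actZl scalerA.
rewrite mulfV ?cocycle_neq0 // scale1r; congr (<< _ *g g >>).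
exact: (scale1r ((diag_val w)@_g : W)).
Qed.

Fact alpha_actDr : right_distributive alpha_act +%R.
Proof. by move=> x v w; apply: val_inj; exact: tconvDr. Qed.

Fact alpha_actDl w : {morph alpha_act^~ w : x y / x + y}.
Proof. by move=> x y; apply: val_inj; exact: tconvDl. Qed.

HB.instance Definition _ := GRing.Zmodule_isLmodule.Build (alpha_alg a A)
  alpha_mod_type alpha_actA alpha_act1 alpha_actDr alpha_actDl.

Lemma alpha_restrZ (c : F) (w : restr alpha_mod_type) :
  c *: w = c *: (w : diag_type a (mdeg_grading W)).
Proof.
apply: val_inj; rewrite restrZE.
rewrite -[LHS]/(tconv act_op (c *: tens_one a A) (diag_val w)).
rewrite (tconvZl actDl actDr) //; congr (c *: _).
exact: (congr1 val (alpha_act1 w)).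
Qed.

Definition alpha_deg (g : G) : {pred restr alpha_mod_type} :=
  diag_deg (grV := mdeg_grading W) g.

Fact alpha_mod_grading : is_grading alpha_deg.
Proof.
have [sub span ind] := diag_grading a (mdeg_grading W).
split=> [g||]; [|exact: span|exact: ind].
have [s0 sl] := sub g; split=> [|c v w vg wg]; first exact: s0.
by rewrite alpha_restrZ; exact: sl.
Qed.

Fact alpha_mod_degM g h (x : alpha_alg a A) (w : alpha_mod_type) :
  x \in gdeg (alpha_alg a A) g -> w \in alpha_deg h -> x *: w \in alpha_deg (g * h)%g.
Proof.
move=> xg wh.
change (msupp (tconv (a := a) act_op (diag_val x) (diag_val w))
  `<=` [fset (g * h)%g])%fset.
rewrite (tconvEw _ actDl actDr xg wh) !big_seq_fset1.
exact: msuppU_le.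
Qed.

Definition alpha_mod : gradedMod (alpha_alg a A) :=
  @GradedMod F G (alpha_alg a A) alpha_mod_type _ alpha_mod_grading alpha_mod_degM.
End AlphaModule.

Definition alpha (F : fieldType) (G : groupType) (a : cocycle F G)
  (W : gmodule F G) : gmodule F G := GModule (alpha_mod a W).

Section TwistedGroupAlgebra.
Variables (F : fieldType) (G : groupType) (a : cocycle F G).

Definition twisted_deg (g : G) : {pred tensG a F^o} :=
  fun f => (msupp f `<=` [fset g])%fset.

Lemma twisted_degP g f :
  reflect (forall h, h != g -> f@_h = 0) (f \in twisted_deg g).
Proof.
apply: (iffP idP) => [/fsubsetP H h hg|H].
  by apply/mcoeff_outdom/negP => /H; rewrite inE (negbTE hg).
by apply/fsubsetP => h; rewrite inE -mcoeff_neq0; apply: contraNT => /H ->.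
Qed.

Lemma twisted_grading : is_grading twisted_deg.
Proof.
split=> [g|f|s c cd s0 g gs].
- split=> [|c f k /twisted_degP fg /twisted_degP kg].
    by apply/twisted_degP => h _; rewrite mcoeff0.
  apply/twisted_degP => h hg.
  by rewrite mcoeffD mcoeffZ_tens fg // kg // scaler0 addr0.
- exists (msupp f), (fun g => << f@_g *g g >>); split=> [g|]; last exact: monalgE.
  by apply/twisted_degP => h hg; rewrite mcoeffU eq_sym (negbTE hg) mulr0n.
- apply/malgP => h; rewrite mcoeff0.
  have [->|hg] := eqVneq h g; last by move/twisted_degP: (cd g) => ->.
  have := congr1 (fun f : tensG a F^o => f@_g) s0.
  rewrite /= mcoeff0 raddf_sum /= (big_fsetD1 g) //=.
  rewrite big1_fset ?addr0 // => k; rewrite in_fsetD1 => /andP[kg _] _.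
  by move/twisted_degP: (cd k) => ->; rewrite // eq_sym.
Qed.

Fact twisted_degM g h (x y : tensG a F^o) :
  x \in twisted_deg g -> y \in twisted_deg h -> x * y \in twisted_deg (g * h)%g.
Proof.
move=> xg yh.
change (msupp (tconv (a := a) *%R x y) `<=` [fset (g * h)%g])%fset.
rewrite (tconvEw _ (fun p q r : F^o => mulrDl p q r)
  (fun p q r : F^o => mulrDr p q r) xg yh) !big_seq_fset1.
exact: msuppU_le.
Qed.

(* F^a G, with v_g = << 1 *g g >>.                                            *)
Definition twisted_group_alg : gradedAlg F G :=
  @GradedAlg F G (tensG a F^o) _ twisted_grading twisted_degM.
End TwistedGroupAlgebra.

Section GradedEndomorphisms.
Variables (F : fieldType) (G : groupType) (A : gradedAlg F G).
Variable W : gradedMod A.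

Definition endo_deg (g : G) (f : W -> W) : Prop :=
  linear f /\ forall h w, w \in mdeg W h -> f w \in mdeg W (h * g)%g.

Definition is_gendo (f : W -> W) : Prop :=
  exists (s : {fset G}) (c : G -> W -> W),
    (forall g, endo_deg g (c g)) /\ forall w, f w = \sum_(g <- s) c g w.

Let sub g : submod_closed (mdeg W g).
Proof. by case: (mdeg_grading W). Qed.

Lemma endo_degP g c (f k : W -> W) : endo_deg g f -> endo_deg g k ->
  endo_deg g (fun w => c%:A *: f w + k w).
Proof.
move=> [fl fg] [kl kg]; split=> [x u v|h w wh].
  rewrite fl kl !scalerDr !scalerA -scalerAl -scalerAr mul1r mulr1.
  by rewrite addrACA.
by have [_ sl] := sub (h * g)%g; exact: sl c _ _ (fg _ _ wh) (kg _ _ wh).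
Qed.

Lemma endo_deg0 g : endo_deg g (fun=> 0).
Proof.
split=> [x u v|h w _]; first by rewrite scaler0 addr0.
by case: (sub (h * g)%g).
Qed.

Lemma is_gendo_deg g f : endo_deg g f -> is_gendo f.
Proof.
move=> fg; exists [fset g]%fset, (fun h => if h == g then f else fun=> 0).
split=> [h|w]; last by rewrite big_seq_fset1 eqxx.
by case: eqP => [->|_] //; exact: endo_deg0.
Qed.

Lemma is_gendo_linear f : is_gendo f -> linear f.
Proof.
move=> [s [c [cd fE]]] x u v; rewrite !fE scaler_sumr -big_split /=.
by apply: eq_bigr => g _; case: (cd g) => cl _; rewrite cl.
Qed.

Lemma is_gendoP c f k : is_gendo f -> is_gendo k ->
  is_gendo (fun w => c%:A *: f w + k w).
Proof.
move=> [s [p [pd fE]]] [t [q [qd kE]]].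
pose p' g := if g \in s then p g else fun=> 0.
pose q' g := if g \in t then q g else fun=> 0.
exists (s `|` t)%fset, (fun g w => c%:A *: p' g w + q' g w); split=> [g|w].
  apply: endo_degP; rewrite /p' /q'; case: ifP => _ //; exact: endo_deg0.
rewrite big_split -scaler_sumr /= fE kE; congr (_ *: _ + _).
  rewrite -(big_fset_incl _ (fsubsetUl s t)) /= => [|g _ gs].
    by apply: eq_big_seq => g gs; rewrite /p' gs.
  by rewrite /p' (negbTE gs).
rewrite -(big_fset_incl _ (fsubsetUr s t)) /= => [|g _ gs].
  by apply: eq_big_seq => g gs; rewrite /q' gs.
by rewrite /q' (negbTE gs).
Qed.

Lemma is_gendo0 : is_gendo (fun=> 0).
Proof. by apply: (@is_gendo_deg 1%g); exact: endo_deg0. Qed.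

Lemma endo_deg1 : endo_deg 1%g id.
Proof. by split=> // h w; rewrite mulg1. Qed.

Lemma endo_deg_comp g h f k : endo_deg g f -> endo_deg h k ->
  endo_deg (g * h)%g (k \o f).
Proof.
move=> [fl fg] [kl kh]; split=> [x u v|m w wm] /=; first by rewrite fl kl.
by rewrite mulgA; apply/kh/fg.
Qed.

Lemma is_gendo_sum (s : seq G) (c : G -> W -> W) :
  (forall g, is_gendo (c g)) -> is_gendo (fun w => \sum_(g <- s) c g w).
Proof.
move=> cd; elim: s => [|g s IH].
  by under eq_fun do rewrite big_nil; exact: is_gendo0.
under eq_fun do rewrite big_cons.
have := is_gendoP 1 (cd g) IH.
by under eq_fun do rewrite scale1r scale1r.
Qed.

Lemma is_gendo_comp f k : is_gendo f -> is_gendo k -> is_gendo (k \o f).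
Proof.
move=> [s [p [pd fE]]] kd; have kl := is_gendo_linear kd.
pose kl' := GRing.isLinear.Build A W W _ k kl.
pose K : {linear W -> W} := HB.pack k kl'.
have -> : k \o f = fun w => \sum_(g <- s) k (p g w).
  by apply/funext => w /=; rewrite fE; exact: (raddf_sum K).
apply: is_gendo_sum => g; case: kd => [t [q [qd kE]]].
have -> : (fun w => k (p g w)) = fun w => \sum_(h <- t) q h (p g w).
  by apply/funext => w; rewrite kE.
apply: is_gendo_sum => h; exact: is_gendo_deg (endo_deg_comp (pd g) (qd h)).
Qed.

(* The parameter Wn0 only serves to make End^r(G)(W) a nonzero ring.          *)
Record gendo (Wn0 : exists w : W, w != 0) :=
  GEndo { gendo_fun :> W -> W; _ : `[< is_gendo gendo_fun >] }.

HB.instance Definition _ W0 := [isSub for @gendo_fun W0].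
HB.instance Definition _ W0 := [Choice of gendo W0 by <:].

Variable W0 : exists w : W, w != 0.
Local Notation E := (gendo W0).
Implicit Types f k l : E.

Lemma gendoP f : is_gendo f.
Proof. by case: f => f /= /asboolP. Qed.

Definition mkgendo (f : W -> W) (fd : is_gendo f) : E := GEndo W0 (asboolT fd).

Lemma gendo_ext f k : (forall w, f w = k w) -> f = k.
Proof. by move=> fk; apply/val_inj/funext. Qed.

Definition gendo_lin (c : F) f k : E := mkgendo (is_gendoP c (gendoP f) (gendoP k)).
Definition gendo_zero : E := mkgendo is_gendo0.
Definition gendo_add f k : E := gendo_lin 1 f k.
Definition gendo_scale c f : E := gendo_lin c f gendo_zero.
Definition gendo_opp f : E := gendo_scale (-1) f.
Definition gendo_one : E := mkgendo (is_gendo_deg endo_deg1).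
(* Endomorphisms act from the right: f * k is first f, then k.                *)
Definition gendo_mul f k : E := mkgendo (is_gendo_comp (gendoP f) (gendoP k)).

Lemma gendo_addE f k w : gendo_add f k w = f w + k w.
Proof. by rewrite /= !scale1r. Qed.

Lemma gendo_scaleE c f w : gendo_scale c f w = c%:A *: f w.
Proof. exact: addr0. Qed.

Lemma gendo_oppE f w : gendo_opp f w = - f w.
Proof. by rewrite gendo_scaleE scaleN1r scaleN1r. Qed.

Fact gendo_addA : associative gendo_add.
Proof. by move=> f k l; apply: gendo_ext => w; rewrite !gendo_addE addrA. Qed.
Fact gendo_addC : commutative gendo_add.
Proof. by move=> f k; apply: gendo_ext => w; rewrite !gendo_addE addrC. Qed.
Fact gendo_add0 : left_id gendo_zero gendo_add.
Proof. by move=> f; apply: gendo_ext => w; rewrite gendo_addE add0r. Qed.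
Fact gendo_addN : left_inverse gendo_zero gendo_opp gendo_add.
Proof. by move=> f; apply: gendo_ext => w; rewrite gendo_addE gendo_oppE addNr. Qed.

HB.instance Definition _ :=
  GRing.isZmodule.Build E gendo_addA gendo_addC gendo_add0 gendo_addN.

Fact gendo_mulA : associative gendo_mul.
Proof. by move=> f k l; apply: gendo_ext. Qed.
Fact gendo_mul1 : left_id gendo_one gendo_mul.
Proof. by move=> f; apply: gendo_ext. Qed.
Fact gendo_1mul : right_id gendo_one gendo_mul.
Proof. by move=> f; apply: gendo_ext. Qed.
Fact gendo_mulDl : left_distributive gendo_mul +%R.
Proof.
move=> f k l; apply: gendo_ext => w; rewrite [RHS]gendo_addE /= !scale1r.
have := is_gendo_linear (gendoP l) 1 (f w) (k w); by rewrite !scale1r.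
Qed.
Fact gendo_mulDr : right_distributive gendo_mul +%R.
Proof.
by move=> f k l; apply: gendo_ext => w; rewrite [RHS]gendo_addE /= !scale1r.
Qed.
Fact gendo_one_neq0 : gendo_one != 0.
Proof.
have [w w0] := W0; apply: contra_neq w0 => E10.
exact: (congr1 (fun f : E => f w) E10).
Qed.

HB.instance Definition _ := GRing.Zmodule_isNzRing.Build E
  gendo_mulA gendo_mul1 gendo_1mul gendo_mulDl gendo_mulDr gendo_one_neq0.

Fact gendo_scaleA c d f : gendo_scale c (gendo_scale d f) = gendo_scale (c * d) f.
Proof.
apply: gendo_ext => w; rewrite !gendo_scaleE scalerA -scalerAl mul1r.
by rewrite scalerA.
Qed.
Fact gendo_scale1 : left_id 1 gendo_scale.
Proof. by move=> f; apply: gendo_ext => w; rewrite gendo_scaleE !scale1r. Qed.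
Fact gendo_scaleDr : right_distributive gendo_scale +%R.
Proof.
move=> c f k; apply: gendo_ext => w.
by rewrite gendo_scaleE [RHS]gendo_addE !gendo_scaleE gendo_addE scalerDr.
Qed.
Fact gendo_scaleDl f : {morph gendo_scale^~ f : c d / c + d}.
Proof.
move=> c d; apply: gendo_ext => w.
by rewrite gendo_scaleE [RHS]gendo_addE !gendo_scaleE !scalerDl.
Qed.

HB.instance Definition _ := GRing.Zmodule_isLmodule.Build F E
  gendo_scaleA gendo_scale1 gendo_scaleDr gendo_scaleDl.

Fact gendo_scaleAl (c : F) f k : c *: (f * k) = (c *: f) * k.
Proof.
apply: gendo_ext => w; rewrite [LHS]gendo_scaleE /= !addr0.
pose kl' := GRing.isLinear.Build A W W _ k (is_gendo_linear (gendoP k)).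
pose K : {linear W -> W} := HB.pack (k : W -> W) kl'.
exact/esym/(linearZZ K).
Qed.
Fact gendo_scaleAr (c : F) f k : c *: (f * k) = f * (c *: k).
Proof. by apply: gendo_ext. Qed.

HB.instance Definition _ := GRing.Lmodule_isLalgebra.Build F E gendo_scaleAl.
HB.instance Definition _ := GRing.Lalgebra_isAlgebra.Build F E gendo_scaleAr.

Definition gendo_deg (g : G) : {pred E} := fun f => `[< endo_deg g f >].

Lemma gendo_degP g f : reflect (endo_deg g f) (f \in gendo_deg g).
Proof. exact: asboolP. Qed.

Lemma gendo_sumE (s : seq G) (c : G -> E) w :
  (\sum_(g <- s) c g) w = \sum_(g <- s) c g w.
Proof.
by elim: s => [|g s IH]; rewrite ?big_nil // !big_cons -IH; exact: gendo_addE.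
Qed.

Fact gendo_grading : is_grading gendo_deg.
Proof.
split=> [g|f|s c cd s0 g gs].
- split=> [|c f k /gendo_degP fg /gendo_degP kg]; apply/gendo_degP.
    exact: endo_deg0.
  have := endo_degP c fg kg; congr (endo_deg _ _); apply/funext => w.
  by rewrite [RHS]gendo_addE [X in _ = X + _]gendo_scaleE.
- have [s [c [cd fE]]] := gendoP f.
  exists s, (fun g => mkgendo (is_gendo_deg (cd g))); split=> [g|].
    exact/gendo_degP.
  by apply: gendo_ext => w; rewrite gendo_sumE.
- have c0 h w : w \in mdeg W h -> c g w = 0.
    move=> wh; apply: (@grading_indep F G (restr W) (mdeg W) (fun g => h * g)%g
      (fun g => h^-1 * g)%g s (fun g => c g w) (mdeg_grading W)) => //.
    + by move=> k; rewrite mulKg.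
    + by move=> k; rewrite mulVKg.
    + by move=> k; have /gendo_degP[_] := cd k; apply.
    + have := congr1 (fun f : E => f w) s0; by rewrite /= gendo_sumE.
  apply: gendo_ext => w; have [_ span _] := mdeg_grading W.
  have [t [d [dW ->]]] := span w.
  pose kl' := GRing.isLinear.Build A W W _ (c g) (is_gendo_linear (gendoP (c g))).
  pose K : {linear W -> W} := HB.pack (c g : W -> W) kl'.
  rewrite -[LHS]/(K _) (raddf_sum K) big1 // => h _; exact: c0 (dW h).
Qed.

Fact gendo_degM g h (x y : E) :
  x \in gendo_deg g -> y \in gendo_deg h -> x * y \in gendo_deg (g * h)%g.
Proof.
by move=> /gendo_degP xg /gendo_degP yh; apply/gendo_degP/endo_deg_comp.
Qed.

Definition graded_end : gradedAlg F G :=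
  @GradedAlg F G E _ gendo_grading gendo_degM.
End GradedEndomorphisms.

Section Irr.
Variables (F : fieldType) (G : groupType) (KA KM : Type).

(* KA and KM are the cardinals bounding the algebras and the modules.         *)
Definition irr_inv (W : gmodule F G) : Prop :=
  [/\ exists f : gm_alg W -> KA, injective f,
      exists f : W -> KM, injective f,
      G_invariant W & abs_graded_simple W].

(* Classes are plain predicates, not a quotient type: gmodule lives in too    *)
(* large a universe to be a choiceType.                                       *)
Definition eq_class (W : gmodule F G) : gmodule F G -> Prop :=
  fun W' => irr_inv W' /\ equivariant W W'.

Record Irr_inv := IrrInv {
  irr_class :> gmodule F G -> Prop;
  irr_classP : exists2 W, irr_inv W & irr_class = eq_class W }.

Definition class_of_irr (W : gmodule F G) (hW : irr_inv W) : Irr_inv :=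
  @IrrInv (eq_class W) (ex_intro2 _ _ W hW erefl).

(* The default value of xget is irrelevant: b exists and is unique.           *)
Definition omega (c : Irr_inv) : H2 F G :=
  xget (H2_class (trivial_cocycle F G))
    [set b | exists (W : gmodule F G) (W0 : exists w : W, w != 0)
               (beta : cocycle F G),
        [/\ c W, H2_class beta = b &
            galg_iso (graded_end W0) (twisted_group_alg beta)]]%classic.
End Irr.

(* K is an infinite cardinal which is at least |F| and |G|.                   *)
Definition infinite_bound (F : fieldType) (G : groupType) (K : Type) : Prop :=
  [/\ exists f : nat -> K, injective f, exists f : F -> K, injective f
    & exists f : G -> K, injective f].

(* Main.v *)
Require Import Defs.
From HB Require Import structures.
From mathcomp Require Import all_boot all_order all_algebra.
From mathcomp Require Import finmap boolp classical_sets.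
From mathcomp Require Import monalg ring.
(* Imported last so that mdeg is the degree of a graded module, not that of a *)
(* monomial.                                                                  *)
Import Defs.

(** Let W be G-invariant and absolutely graded-simple. Invariance provides, for
each g, a bijective A-linear map phi_g shifting degrees by g, and simplicity
makes phi_g unique up to a scalar: two such maps differ by a degree-preserving
endomorphism. Hence phi_h o phi_g = b(g,h) phi_gh for scalars b(g,h), and
associativity of composition says that b is a 2-cocycle ([frame_exists]).
Such a family is called here an endomorphism frame with cocycle b. It is a
homogeneous basis of End^r(G)(W), which is therefore the twisted group algebra
F^b G ([graded_end_of_frame]), and rescaling it changes b by a coboundary. As
frames can be read off an isomorphism with F^b G and transported along
equivariances, omega of the class of W is the class of b ([omega_frame]).

Twisting by a multiplies this cocycle by a: on alpha(W) the maps
    v_h (x) w |-> v_h v_g (x) phi_g(w)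
commute with alpha(A), and compose with structure constants a(g,k) b(g,k)
([twist_frame]). So a = omega / b solves the problem, once alpha(W) is known to
be again invariant, absolutely graded-simple and small enough. Invariance comes
from its frame. The rest comes from the linear bijection
    sum v_g (x) w_g |-> sum w_g
from alpha(W) to W ([diag_total]): it preserves degrees and is A-linear up to
the non-zero scalars a(g,h) on homogeneous elements, so graded submodules and
degree-preserving endomorphisms correspond, and it bounds cardinals without any
cardinal arithmetic.

Surjectivity then only requires one element of the monoid to start from: the
group algebra as a module over itself, whose frame is right multiplication by
the group elements ([regular_irr]). Here cardinals do matter: the group algebra
embeds in every infinite K that contains F and G because the finite sequences
over K embed in K ([seq_embeds]), which is proved with Zorn's lemma. *)

Set Implicit Arguments.
Unset Strict Implicit.
Unset Printing Implicit Defensive.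

Import GRing.Theory.
Local Open Scope ring_scope.

(** * Finite sequences over an infinite set *)

Section InfiniteCardinals.
Local Open Scope classical_set_scope.

Definition embeds (K : Type) (A B : set K) : Prop :=
  exists f : K -> K, (forall x, A x -> B (f x)) /\
    forall x y, A x -> A y -> f x = f y -> x = y.

Lemma chain_common (T : Type) (F : set (set T)) X Y p q :
  total_on F subset -> F X -> F Y -> X p -> Y q ->
  exists Z, [/\ F Z, Z p & Z q].
Proof.
move=> Ftot FX FY Xp Yq; have [XY|YX] := Ftot _ _ FX FY.
  by exists Y; split=> //; exact: XY.
by exists X; split=> //; exact: YX.
Qed.

(** Comparability of cardinals: a maximal partial matching between A and B
exhausts one of the two sides, since otherwise one more pair could be added. *)
Lemma embeds_total (K : Type) (A B : set K) : embeds A B \/ embeds B A.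
Proof.
pose P (M : set (K * K)) := [/\ forall p, M p -> A p.1 /\ B p.2,
  forall x y y', M (x, y) -> M (x, y') -> y = y' &
  forall x x' y, M (x, y) -> M (x', y) -> x = x'].
have [F FP Ftot|M [[MAB Mfun Minj] Mmax]] := @Zorn_bigcup _ P.
  split=> [p [X FX Xp]|x y y' [X FX Xp] [Y FY Yp]|x x' y [X FX Xp] [Y FY Yp]].
  - by have [H _ _] := FP _ FX; exact: H.
  - have [Z [/FP[_ H _] Zp Zq]] := chain_common Ftot FX FY Xp Yp; exact: H Zp Zq.
  - have [Z [/FP[_ _ H] Zp Zq]] := chain_common Ftot FX FY Xp Yp; exact: H Zp Zq.
have [AM|/existsNP[a /not_implyP[Aa aM]]] :=
    pselect (forall x, A x -> exists y, M (x, y)).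
  left; have /choice[f fM] : forall x, exists y, A x -> M (x, y).
    move=> x; have [Ax|nAx] := pselect (A x); last by exists x.
    by have [y] := AM x Ax; exists y.
  exists f; split=> [x /fM/MAB[]//|x y /fM Mx /fM My xy].
  by apply: (Minj _ _ (f x)) => //; rewrite xy.
right; have BM y : B y -> exists x, M (x, y).
  move=> By; apply: contrapT => yM.
  apply: (Mmax (M `|` [set (a, y)])).
    split=> [|H]; first exact: subsetUl.
    by apply: aM; exists y; apply: H; right.
  split=> [p [/MAB//|->//]|x z z' [xz|xz] [xz'|xz']|x x' z [xz|xz] [x'z|x'z]].
  - exact: Mfun xz xz'.
  - by case: xz' xz => -> _ /(ex_intro _ z)/aM.
  - by case: xz xz' => -> _ /(ex_intro _ z')/aM.
  - by case: xz' xz => _ -> [].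
  - exact: Minj xz x'z.
  - by case: x'z xz => _ -> /(ex_intro _ x)/yM.
  - by case: xz x'z => _ -> /(ex_intro _ x')/yM.
  - by case: xz x'z => -> -> [].
have /choice[f fM] : forall y, exists x, B y -> M (x, y).
  move=> y; have [By|nBy] := pselect (B y); last by exists y.
  by have [x] := BM y By; exists x.
exists f; split=> [y /fM/MAB[]//|x y /fM Mx /fM My xy].
by apply: (Mfun (f x)) => //; rewrite xy.
Qed.

(** R is viewed as a multivalued map from sequences to codes. The codes count as
letters, so that coding the sequences over the support never leaves it. *)
Definition support_of (K : eqType) (R : set (seq K * K)) : set K :=
  [set x | exists s k, R (s, k) /\ (x = k \/ x \in s)].

(** These relations approximate an injective coding of all sequences. The empty
sequence is left out so that the empty relation qualifies, and Zorn's lemma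
applies without a starting point. *)
Definition seq_coding (K : eqType) (R : set (seq K * K)) : Prop :=
  (forall s s' k, R (s, k) -> R (s', k) -> s = s') /\
  forall s, s != [::] -> (forall x, x \in s -> support_of R x) ->
    exists k, R (s, k).

Lemma support_ofS (K : eqType) (R R' : set (seq K * K)) :
  R `<=` R' -> support_of R `<=` support_of R'.
Proof. by move=> RR x [s [k [Rsk xk]]]; exists s, k; split; [exact: RR|]. Qed.

(** A sequence over the support of the union has finitely many letters, so all
of them lie in the support of a single member of the chain. *)
Lemma seq_coding_bigcup (K : eqType) (F : set (set (seq K * K))) :
  F `<=` @seq_coding K -> total_on F subset ->
  seq_coding (\bigcup_(R in F) R).
Proof.
move=> FP Ftot; split=> [s s' k [X FX Xp] [Y FY Yp]|s s0 sF].
  have [Z [/FP[H _] Zp Zq]] := chain_common Ftot FX FY Xp Yp; exact: H Zp Zq.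
suff [R FR sR] : exists2 R, F R & forall x, x \in s -> support_of R x.
  by have [k Rk] := (FP _ FR).2 _ s0 sR; exists k; exists R.
have mem x : support_of (\bigcup_(R in F) R) x -> exists2 R, F R & support_of R x.
  by move=> [t [k [[R FR Rtk] xk]]]; exists R => //; exists t, k.
case: s s0 sF => // x s _; elim: s x => [|y s IH] x sF.
  have [R FR Rx] := mem x (sF x (mem_head _ _)).
  by exists R => // y; rewrite inE => /eqP ->.
have [R FR Rx] := mem x (sF x (mem_head _ _)).
have [|R' FR' R's] := IH y; first by move=> z zs; apply: sF; rewrite inE zs orbT.
have [RR'|R'R] := Ftot _ _ FR FR'; [exists R' => // | exists R => //] => z;
  rewrite inE => /orP[/eqP ->|zs] //.
- exact: (support_ofS RR').
- exact: R's.
- exact: (support_ofS R'R) (R's _ zs).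
Qed.

Lemma inj_map_in (K : eqType) (L : Type) (X : set K) (f : K -> L) s t :
  (forall x y, X x -> X y -> f x = f y -> x = y) ->
  (forall x, x \in s -> X x) -> (forall x, x \in t -> X x) ->
  map f s = map f t -> s = t.
Proof.
move=> fI; elim: s t => [|x s IH] [|y t] //= sX tX [fxy fst]; congr (_ :: _).
  by apply: fI => //; [apply: sX|apply: tX]; rewrite mem_head.
by apply: IH => // z zs; [apply: sX|apply: tX]; rewrite inE zs orbT.
Qed.

Definition codes (K : eqType) (X : set K) (c : seq K -> K) : Prop :=
  (forall s, s != [::] -> (forall x, x \in s -> X x) -> X (c s)) /\
  forall s t, s != [::] -> (forall x, x \in s -> X x) ->
    t != [::] -> (forall x, x \in t -> X x) -> c s = c t -> s = t.

Lemma seq_coding_fun (K : eqType) (k0 : K) (R : set (seq K * K)) :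
  seq_coding R -> exists c, codes (support_of R) c.
Proof.
move=> [Rinj Rtot].
have /choice[c cR] : forall s, exists k, s != [::] ->
    (forall x, x \in s -> support_of R x) -> R (s, k).
  move=> s; have [[s0 sR]|sR] :=
    pselect (s != [::] /\ forall x, x \in s -> support_of R x).
    by have [k Rk] := Rtot s s0 sR; exists k.
  by exists k0 => s0 sR'; case: sR.
exists c; split=> [s s0 sR|s t s0 sR t0 tR cst].
  by exists s, (c s); split; [exact: cR|left].
by apply: (Rinj _ _ (c s)); [|rewrite cst]; exact: cR.
Qed.

(** If X codes its own sequences and Z is at most twice as large as X, then Z
embeds in X: the elements of X are coded as one-letter words, the others as
two-letter words. *)
Lemma codes_double (K : eqType) (X Z : set K) c (g : K -> K) :
  codes X c -> (forall x, Z x -> ~ X x -> X (g x)) ->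
  (forall x y, Z x -> ~ X x -> Z y -> ~ X y -> g x = g y -> x = y) ->
  exists2 e : K -> K, forall x, Z x -> X (e x) &
    forall x y, Z x -> Z y -> e x = e y -> x = y.
Proof.
move=> [cX cI] gX gI.
have in1 x : X x -> forall z, z \in [:: x] -> X z.
  by move=> Xx z; rewrite inE => /eqP ->.
have in2 x : X x -> forall z, z \in [:: x; x] -> X z.
  by move=> Xx z; rewrite !inE => /orP[] /eqP ->.
exists (fun x => if pselect (X x) then c [:: x] else c [:: g x; g x]).
  move=> x Zx; case: pselect => Xx; apply: cX => //; first exact: in1.
  exact/in2/gX.
move=> x y Zx Zy; case: pselect => Xx; case: pselect => Xy.
- by move=> /(cI (_ :: _) (_ :: _) isT (in1 _ Xx) isT (in1 _ Xy))[].
- by move=> /(cI (_ :: _) (_ :: _) isT (in1 _ Xx) isT (in2 _ (gX _ Zy Xy)))[].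
- by move=> /(cI (_ :: _) (_ :: _) isT (in2 _ (gX _ Zx Xx)) isT (in1 _ Xy))[].
- move=> /(cI (_ :: _) (_ :: _) isT (in2 _ (gX _ Zx Xx)) isT (in2 _ (gX _ Zy Xy)))[].
  by move=> + _; exact: gI.
Qed.

(** The countability of the finite sequences of numbers, transported to a copy
of the numbers inside K. *)
Lemma seq_coding_nat (K : eqType) (i : nat -> K) : injective i ->
  seq_coding [set p | exists t, p = (map i t, i (choice.pickle t))].
Proof.
move=> iI; split=> [s s' k [t [-> ->]] [t' [-> /iI/(pcan_inj choice.pickleK) ->]]//|s _ sR].
have [t ->] : exists t, s = map i t.
  elim: s sR => [|x s IH] sR; first by exists [::].
  have [z zs|t ->] := IH; first by apply: sR; rewrite inE zs orbT.
  have [_ [_ [[u [-> ->]] [->|/mapP[n _ ->]]]]] := sR x (mem_head _ _).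
    by exists (choice.pickle u :: t).
  by exists (n :: t).
by exists (i (choice.pickle t)), t.
Qed.

(** Let R be a maximal partial coding, with support X. If X embedded in its
complement, with image Y, the sequences over the union of X and Y could be coded
in X, hence in Y, which would extend R. So the complement embeds in X, all of K
is at most twice as large as X, and the sequences over K can be coded in X. *)
Lemma seq_embeds (K : eqType) (i : nat -> K) : injective i ->
  exists c : seq K -> K, injective c.
Proof.
move=> iI; have [F|R [Rc Rmax]] := @Zorn_bigcup _ (@seq_coding K).
  exact: seq_coding_bigcup.
have [c [cX cI]] := seq_coding_fun (i 0%N) Rc.
set X := support_of R in cX cI.
(* The empty relation is not maximal: K contains a copy of the numbers. *)
have [x0 Xx0] : exists x, X x.
  apply: contrapT => X0.
  have R0 p : ~ R p.
    by case: p => s k Rsk; apply: X0; exists k, s, k; split=> //; left.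
  apply: Rmax (seq_coding_nat iI); split=> [p /R0//|].
  by move=> /(_ ([::], i (choice.pickle ([::] : seq nat)))) /(_ (ex_intro _ [::] erefl))/R0.
have [[f [fX fI]]|[f [fX fI]]] := embeds_total X (~` X); last first.
  have [x _ /fX//|x y _ Xx _ Xy /fI->//|e eX eI] :=
    codes_double (Z := setT) (g := f) (conj cX cI).
  have sX s y : y \in e x0 :: map e s -> X y.
    by rewrite inE => /orP[/eqP ->|/mapP[z _ ->]]; exact: eX.
  (* The letter e x0 in front brings the empty sequence into the domain of c. *)
  exists (fun s => c (e x0 :: map e s)) => s t /(cI (_ :: _) (_ :: _) isT (sX s) isT (sX t))[].
  by apply: inj_map => x y; exact: eI.
exfalso.
have /choice[g gP] : forall y, exists x, (exists2 x, X x & y = f x) -> X x /\ y = f x.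
  move=> y; have [[x Xx yx]|yX] := pselect (exists2 x, X x & y = f x).
    by exists x.
  by exists y.
pose Z := X `|` [set y | exists2 x, X x & y = f x].
have [x [//|/gP[]//]|x y [//|/gP[_ xE]] _ [//|/gP[_ yE]] _ gxy|e eX eI] :=
  codes_double (Z := Z) (g := g) (conj cX cI).
  by rewrite xE yE gxy.
(* The codes of the new sequences are put in Y, away from those of R. *)
pose new : set (seq K * K) := [set p | [/\ p.1 != [::],
  forall x, x \in p.1 -> Z x, ~ forall x, x \in p.1 -> X x &
  p.2 = f (c (map e p.1))]].
have eXs s : (forall x, x \in s -> Z x) -> forall x, x \in map e s -> X x.
  by move=> sZ _ /mapP[x xs ->]; exact/eX/sZ.
have e0 s : s != [::] -> map e s != [::] by case: s.
have newX s k : new (s, k) -> exists2 x, X x & k = f x.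
  move=> [/= s0 sZ _ ->]; exists (c (map e s)) => //.
  by apply: cX; [exact: e0|exact: eXs].
have RX s k : R (s, k) -> X k by exists s, k; split=> //; left.
have supZ x : support_of (R `|` new) x -> Z x.
  move=> [s [k [[Rsk|nsk] xsk]]]; first by left; exists s, k.
  case: xsk => [->|]; last by case: nsk => _ /= + _ _ => /[apply].
  by right; exact: newX nsk.
apply: (Rmax (R `|` new)).
  split=> [|H]; first exact: subsetUl.
  suff n0 : new ([:: f x0], f (c [:: e (f x0)])).
    by move: (H _ (or_intror n0)) => /RX; apply: fX; apply: cX => // x; rewrite inE => /eqP ->;
      apply: eX; right; exists x0.
  split=> //= [x|/(_ (f x0) (mem_head _ _))]; last exact: fX.
  by rewrite inE => /eqP ->; right; exists x0.
split=> [s t k [Rs|ns] [Rt|nt]|s s0 sZ].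
- exact: Rc.1 Rs Rt.
- by have [x Xx kx] := newX _ _ nt; case: (fX x Xx); rewrite -kx; exact: RX Rs.
- by have [x Xx kx] := newX _ _ ns; case: (fX x Xx); rewrite -kx; exact: RX Rt.
- case: ns nt => /= s0 sZ _ -> [/= t0 tZ _ /fI est].
  move: (est (cX _ (e0 _ s0) (eXs _ sZ)) (cX _ (e0 _ t0) (eXs _ tZ))).
  move=> /(cI _ _ (e0 _ s0) (eXs _ sZ) (e0 _ t0) (eXs _ tZ)).
  exact: (inj_map_in eI sZ tZ).
have [sX|sX] := pselect (forall x, x \in s -> X x).
  by have [k Rk] := Rc.2 s s0 sX; exists k; left.
by exists (f (c (map e s))); right; split=> // x /sZ; exact: supZ.
Qed.
End InfiniteCardinals.

(** * Graded spaces and graded isomorphisms *)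

Section GradedSpaces.
Variables (F : fieldType) (G : groupType).

Lemma grading_ind (V : lmodType F) (Vd : G -> {pred V}) (P : V -> Prop) :
  is_grading Vd -> P 0 -> (forall u v, P u -> P v -> P (u + v)) ->
  (forall g v, v \in Vd g -> P v) -> forall v, P v.
Proof.
move=> [_ span _] P0 PD PV v; have [s [c [cV ->]]] := span v.
by apply: big_ind => // g _; exact: PV (cV g).
Qed.

(** Compare the homogeneous components of f v, which has degree g, with the
images of those of v: all but the one of degree g are killed by f. *)
Lemma graded_inv (V V' : lmodType F) (Vd : G -> {pred V}) (Vd' : G -> {pred V'})
    (f : V -> V') :
  {morph f : u v / u + v} -> is_grading Vd -> is_grading Vd' -> injective f ->
  (forall g v, v \in Vd g -> f v \in Vd' g) ->
  forall g v, f v \in Vd' g -> v \in Vd g.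
Proof.
move=> fD [sub span _] [sub' _ ind'] fI fV g v fvg.
have f0 : f 0 = 0 by apply: (addrI (f 0)); rewrite -fD !addr0.
have [s [c [cV vE]]] := span v.
pose d h := (if h \in s then f (c h) else 0) - (if h == g then f v else 0).
have dV h : d h \in Vd' h.
  have [V0 VZ] := sub' h; rewrite /d addrC -scaleN1r.
  apply: VZ; first by case: eqP => // ->.
  by case: ifP => // _; exact: fV.
have d0 : \sum_(h <- (s `|` [fset g])%fset) d h = 0.
  rewrite sumrB -(big_fset_incl _ (fsubsetUl s [fset g]%fset)) /=; last first.
    by move=> h _ /negbTE ->.
  rewrite [X in _ - X](big_fsetD1 g) ?inE ?eqxx ?orbT //= [X in _ - (_ + X)]big1_fset => [|h].
    rewrite addr0.
    apply/eqP; rewrite subr_eq0 [in f v]vE (big_morph f fD f0); apply/eqP.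
    by apply: eq_big_seq => h ->.
  by rewrite in_fsetD1 => /andP[/negbTE ->].
have := ind' _ d dV d0 g; rewrite !inE eqxx orbT => /(_ isT)/eqP.
rewrite /d eqxx subr_eq0; case: ifP => _ /eqP fE.
  by rewrite -(fI _ _ fE).
by rewrite -(fI 0 v _) ?f0 //; have [] := sub g.
Qed.

Lemma galg_iso_sym (A B : gradedAlg F G) : galg_iso A B -> galg_iso B A.
Proof.
move=> [f [[k fK kK] fA]].
have kl : linear k by move=> c x y; apply: (can_inj fK); rewrite linearP /= !kK.
have km : monoid_morphism k.
  by split=> [|x y]; apply: (can_inj fK); rewrite ?rmorph1 ?rmorphM /= !kK.
pose K : {lrmorphism B -> A} := HB.pack k
  (GRing.isLinear.Build _ _ _ _ k kl) (GRing.isMonoidMorphism.Build _ _ k km).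
exists K; split=> [|g x xg]; first by exists f.
apply: (graded_inv (f := f) (raddfD f) (gdeg_grading A) (gdeg_grading B)) => //.
  exact: can_inj fK.
by rewrite /= kK.
Qed.

End GradedSpaces.

Lemma inj_surj_bij (T U : Type) (f : T -> U) :
  injective f -> (forall u, exists t, f t = u) -> bijective f.
Proof. by move=> fI /choice[k kK]; exists k => // t; apply: fI; rewrite kK. Qed.

(** * The homogeneous basis of a twisted group algebra *)

Section TwistedBasis.
Variables (F : fieldType) (G : groupType) (b : cocycle F G).

Definition twisted_basis (g : G) : twisted_group_alg b := << 1 *g g >> : tensG b F^o.

Lemma twisted_basisM g k : twisted_basis g * twisted_basis k = b g k *: twisted_basis (g * k)%g.
Proof.
apply: (etrans (tensMUU b (A := F^o) _ _ _ _)).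
by rewrite /twisted_basis mulr1 (scale_tensU b).
Qed.

Lemma twisted_basis1 : twisted_basis 1%g = b 1%g 1%g *: 1.
Proof.
rewrite /twisted_basis -[1 in RHS]/(tens_one b F^o) /tens_one (scale_tensU b) scalerA.
by rewrite mulfV ?scale1r // cocycle_neq0.
Qed.

Lemma twisted_basis_deg g : twisted_basis g \in gdeg (twisted_group_alg b) g.
Proof. exact: msuppU_le. Qed.
End TwistedBasis.

(** * Endomorphism frames *)

Section EndoFrames.
Variables (F : fieldType) (G : groupType).

(** The values phi g of a graded algebra homomorphism from F^b G to End^r(G)(W)
at the basis vectors v_g. Cocycles are not normalized: the unit of F^b G is
b(1,1)^-1 v_1, so preservation of the unit is the condition on phi 1. *)
Definition endo_frame (A : gradedAlg F G) (W : gradedMod A) (b : cocycle F G)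
    (phi : G -> W -> W) : Prop :=
  [/\ forall g, endo_deg g (phi g),
      forall w, phi 1%g w = (b 1%g 1%g)%:A *: w
    & forall g h w, phi h (phi g w) = (b g h)%:A *: phi (g * h)%g w].

Lemma scale_algK (A : algType F) (W : lmodType A) (c : F) (w : W) :
  c != 0 -> (c^-1)%:A *: (c%:A *: w) = w.
Proof. by move=> c0; rewrite scalerA -scalerAl mul1r scalerA mulVf // !scale1r. Qed.

Lemma scale_alg_eq0 (A : algType F) (W : lmodType A) (c : F) (w : W) :
  c%:A *: w = 0 -> w != 0 -> c = 0.
Proof.
move=> cw w0; apply/eqP; apply: contra_neqT w0 => c0.
by rewrite -(scale_algK w c0) cw scaler0.
Qed.

Lemma scale_alg_inj (A : algType F) (W : lmodType A) (c d : F) (w : W) :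
  c%:A *: w = d%:A *: w -> w != 0 -> c = d.
Proof.
move=> cdw w0; apply/eqP; rewrite -subr_eq0; apply/eqP.
by apply: scale_alg_eq0 w0; rewrite scalerBl scalerBl cdw subrr.
Qed.

Lemma scale_algA (A : algType F) (W : lmodType A) (c d : F) (w : W) :
  c%:A *: (d%:A *: w) = (c * d)%:A *: w.
Proof. by rewrite scalerA -scalerAl mul1r scalerA. Qed.

Lemma scale_algC (A : algType F) (W : lmodType A) (c : F) x (w : W) :
  c%:A *: (x *: w) = x *: (c%:A *: w).
Proof. by rewrite !scalerA -scalerAl -scalerAr mul1r mulr1. Qed.

Variables (A : gradedAlg F G) (W : gradedMod A).

Lemma endo_degZ g f c (w : W) : endo_deg (W := W) g f -> f (c *: w) = c *: f w.
Proof.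
move=> [fl _].
pose K : {linear W -> W} := HB.pack f (GRing.isLinear.Build A W W _ f fl).
exact: (linearZZ K).
Qed.

(** v_g is invertible in F^b G, with inverse a multiple of v_(g^-1). *)
Lemma frame_bij b phi g : endo_frame (W := W) b phi -> bijective (phi g).
Proof.
move=> [pd p1 pM].
have pK h w : phi h^-1%g (phi h w) = (b h h^-1%g * b 1%g 1%g)%:A *: w.
  by rewrite pM mulgV p1 scale_algA.
have n0 h : b h h^-1%g * b 1%g 1%g != 0 by rewrite mulf_neq0 ?cocycle_neq0.
have Lg := pK g; have := pK g^-1%g; rewrite invgK => Rg.
have ng := n0 g; have := n0 g^-1%g; rewrite invgK => ng'.
exists (fun w => (b g g^-1%g * b 1%g 1%g)^-1%:A *: phi g^-1%g w) => w.
  by rewrite Lg scale_algK.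
have <- : phi g ((b g^-1%g g * b 1%g 1%g)^-1%:A *: phi g^-1%g w) = w.
  by rewrite (endo_degZ _ _ (pd g)) Rg scale_algK.
by rewrite Lg scale_algK.
Qed.

(** Graded Schur lemma: f followed by the inverse of p preserves degrees. *)
Lemma endo_deg_uniq g p f : abs_graded_simple W ->
  endo_deg (W := W) g p -> bijective p -> endo_deg (W := W) g f ->
  exists c : F, forall w, f w = c%:A *: p w.
Proof.
move=> [_ _ Wend] [pl pg] [k phiK kphi] [fl fd].
have kl : linear k.
  by move=> c x y; apply: (can_inj phiK); rewrite pl !kphi.
pose P : {linear W -> W} := HB.pack p (GRing.isLinear.Build A W W _ p pl).
have kf : linear (k \o f).
  by move=> c x y /=; rewrite fl kl.
pose KF : {linear W -> W} := HB.pack (k \o f) (GRing.isLinear.Build A W W _ (k \o f) kf).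
have [h w wh|c cE] := Wend KF.
  apply: (graded_inv (V := restr W) (V' := restr W) (raddfD P) (mdeg_grading W)
    (mdeg_grading (suspension W g)) (can_inj phiK) pg).
  by rewrite /= kphi; exact: fd.
exists c => w; rewrite -[LHS]kphi -[k (f w)]/(KF w) cE.
exact: (linearZZ P).
Qed.

Lemma endo_deg0E g f : endo_deg (W := W) g f -> f 0 = 0.
Proof. by move=> fg; have := endo_degZ 0 0 fg; rewrite !scale0r. Qed.

Lemma bij_endo_neq0 g f w : endo_deg (W := W) g f -> bijective f ->
  w != 0 -> f w != 0.
Proof.
by move=> fg /bij_inj fI; apply: contra_neq => fw; apply: fI; rewrite fw (endo_deg0E fg).
Qed.

(** By uniqueness up to scalars, phi_h o phi_g is a multiple of phi_gh; bracketing
phi_k o phi_h o phi_g in two ways gives the cocycle identity. *)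
Lemma frame_exists : G_invariant W -> abs_graded_simple W ->
  exists b phi, endo_frame (W := W) b phi.
Proof.
move=> Winv Ws; have [[w0 w00] _ _] := Ws.
have /choice[p pP] : forall g, exists p : W -> W, endo_deg (W := W) g p /\ bijective p.
  move=> g; have [f [fbij fd]] := Winv g; exists f; split=> //.
  split=> [|h w wh]; first exact: linearP.
  exact: fd.
have pd g := (pP g).1; have pb g := (pP g).2.
have /choice[b bP] : forall gh, exists c : F, forall w,
    p gh.2 (p gh.1 w) = c%:A *: p (gh.1 * gh.2)%g w.
  move=> [g h] /=; apply: (endo_deg_uniq Ws (pd _) (pb _)).
  exact: (endo_deg_comp (pd g) (pd h)).
have b0 g h : b (g, h) != 0.
  have : p h (p g w0) != 0.
    by apply: (bij_endo_neq0 (pd _)) => //; apply: (bij_endo_neq0 (pd _)).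
  by rewrite (bP (g, h)) /=; apply: contra_neq => ->; rewrite !scale0r.
have bE g h k : b (g, h) * b ((g * h)%g, k) = b (g, (h * k)%g) * b (h, k).
  have : p k (p h (p g w0)) = p k (p h (p g w0)) by [].
  rewrite [in LHS](bP (g, h)) (endo_degZ _ _ (pd k)) (bP ((g * h)%g, k)).
  rewrite (bP (h, k)) (bP (g, (h * k)%g)) /= !scale_algA -mulgA.
  move/scale_alg_inj ->; first by rewrite mulrC.
  exact: bij_endo_neq0.
exists (Cocycle b0 bE), p; split=> //= [w|g h w]; last exact: (bP (g, h)).
apply: (bij_inj (pb 1%g)).
by rewrite (bP (1%g, 1%g)) /= mulg1 (endo_degZ _ _ (pd 1%g)).
Qed.

(** The scalars relating the two frames form the cochain whose coboundary relates
the two cocycles. *)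
Lemma frame_cohomologous b b' phi phi' : abs_graded_simple W ->
  endo_frame (W := W) b phi -> endo_frame (W := W) b' phi' -> cohomologous b b'.
Proof.
move=> Ws fr fr'; have [[w0 w00] _ _] := Ws.
have [pd _ pM] := fr; have [pd' _ pM'] := fr'.
have /choice[c cP] : forall g, exists c : F, forall w, phi' g w = c%:A *: phi g w.
  by move=> g; exact: (endo_deg_uniq Ws (pd g) (frame_bij g fr) (pd' g)).
have c0 g : c g != 0.
  have := bij_endo_neq0 (pd' g) (frame_bij g fr') w00.
  by rewrite cP; apply: contra_neq => ->; rewrite !scale0r.
exists c => // g h; have := pM' g h w0.
rewrite !cP (endo_degZ _ _ (pd h)) pM !scale_algA => /scale_alg_inj E.
have {}E := E (bij_endo_neq0 (pd _) (frame_bij _ fr) w00).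
have := c0 (g * h)%g => n0; apply: (mulIf n0); rewrite -E.
by field.
Qed.

(** The frame is the family of the images of the v_g under the isomorphism from
F^b G. *)
Lemma frame_of_graded_end (W0 : exists w : W, w != 0) b :
  galg_iso (graded_end W0) (twisted_group_alg b) ->
  exists phi, endo_frame (W := W) b phi.
Proof.
move=> /galg_iso_sym[h [_ hd]].
exists (fun g => gendo_fun (h (twisted_basis b g))); split=> [g|w|g k w].
- exact/gendo_degP/hd/twisted_basis_deg.
- by rewrite twisted_basis1 linearZ rmorph1; exact: gendo_scaleE.
- rewrite -[LHS]/((h (twisted_basis b g) * h (twisted_basis b k)) w) -rmorphM /= twisted_basisM linearZ.
  exact: gendo_scaleE.
Qed.

(** * The graded endomorphism ring as a twisted group algebra *)

Section FrameIso.
Variables (W0 : exists w : W, w != 0) (b : cocycle F G) (phi : G -> W -> W).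
Hypotheses (Ws : abs_graded_simple W) (fr : endo_frame (W := W) b phi).
Local Notation T := (twisted_group_alg b).

Definition frame_comb (x : T) (w : W) : W :=
  \sum_(g <- msupp (x : tensG b F^o)) ((x : tensG b F^o)@_g)%:A *: phi g w.

Lemma frame_combEw (d : {fset G}) (x : T) w :
  (msupp (x : tensG b F^o) `<=` d)%fset ->
  frame_comb x w = \sum_(g <- d) ((x : tensG b F^o)@_g)%:A *: phi g w.
Proof.
move=> xd; rewrite /frame_comb (big_fset_incl _ xd) //= => g _ gx.
by rewrite (mcoeff_outdom gx) scale0r scale0r.
Qed.

Lemma frame_comb_gendo x : is_gendo (W := W) (frame_comb x).
Proof.
have [pd _ _] := fr.
exists (msupp (x : tensG b F^o)), (fun g w => ((x : tensG b F^o)@_g)%:A *: phi g w).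
split=> // g; have := @endo_degP F G A W g (x : tensG b F^o)@_g _ _ (pd g) (endo_deg0 W g).
by under eq_fun do rewrite addr0.
Qed.

Definition frame_end (x : T) : graded_end W0 := mkgendo W0 (frame_comb_gendo x).

Fact frame_end_linear : linear frame_end.
Proof.
move=> c x y; apply: gendo_ext => w; rewrite [RHS]gendo_addE gendo_scaleE /=.
set d := (msupp (x : tensG b F^o) `|` msupp (y : tensG b F^o))%fset.
rewrite (@frame_combEw d x) ?fsubsetUl // (@frame_combEw d y) ?fsubsetUr //.
rewrite (@frame_combEw d); last first.
  apply: fsubset_trans (msuppD_le _ _) _.
  exact: fsetUSS (msuppZ_tens (a := b) c x) (fsubset_refl _).
rewrite scaler_sumr -big_split /=; apply: eq_bigr => g _.
by rewrite mcoeffD (mcoeffZ_tens (a := b)) scalerDl scalerDl scale_algA.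
Qed.

HB.instance Definition _ :=
  GRing.isLinear.Build F T (graded_end W0) _ frame_end frame_end_linear.

Lemma frame_endU (c : F) g w :
  frame_end (<< (c : F^o) *g g >> : tensG b F^o) w = c%:A *: phi g w.
Proof.
by rewrite /= (@frame_combEw [fset g]%fset) ?msuppU_le // big_seq_fset1 mcoeffUU.
Qed.

Fact frame_end_monoid : monoid_morphism frame_end.
Proof.
have [pd p1 pM] := fr; split=> [|x y].
  apply: gendo_ext => w.
  rewrite -[1 in LHS]/(tens_one b F^o) /tens_one frame_endU p1 scale_algA.
  by rewrite -[X in (X * _)%:A]/(_ * 1) mulr1 mulVf ?cocycle_neq0 // !scale1r.
pose xs : T := \sum_(g <- msupp (x : tensG b F^o)) (<< (x : tensG b F^o)@_g *g g >> : tensG b F^o).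
pose ys : T := \sum_(g <- msupp (y : tensG b F^o)) (<< (y : tensG b F^o)@_g *g g >> : tensG b F^o).
have -> : x = xs by exact: monalgE.
have -> : y = ys by exact: monalgE.
rewrite /xs /ys mulr_suml !raddf_sum mulr_suml /=; apply: eq_bigr => g _.
rewrite mulr_sumr !raddf_sum mulr_sumr /=; apply: eq_bigr => h _.
apply: gendo_ext => w; rewrite -[RHS]/(frame_end _ (frame_end _ w)).
rewrite (tensMUU b (A := F^o)) !frame_endU (endo_degZ _ _ (pd h)) pM !scale_algA.
by congr (_ *: _); congr (_ *: _); rewrite -[_ *: _]/(_ * _); ring.
Qed.

HB.instance Definition _ :=
  GRing.isMonoidMorphism.Build T (graded_end W0) frame_end frame_end_monoid.

Lemma frame_end_deg g x : x \in gdeg T g -> frame_end x \in gdeg (graded_end W0) g.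
Proof.
have [pd _ _] := fr; move=> xg; apply/gendo_degP.
have -> : gendo_fun (frame_end x) = fun w => ((x : tensG b F^o)@_g)%:A *: phi g w + 0.
  by apply/funext => w; rewrite /= (@frame_combEw [fset g]%fset) // big_seq_fset1 addr0.
exact: (@endo_degP F G A W g _ _ _ (pd g) (endo_deg0 W g)).
Qed.

(** The homogeneous terms of an element of the kernel are mapped to endomorphisms
of distinct degrees, hence each to zero, while phi g is not zero. *)
Lemma frame_end_inj : injective frame_end.
Proof.
have [pd _ _] := fr; have [w0 w00] := W0.
apply: raddf_inj => x x0; apply/malgP => g; rewrite mcoeff0.
case: (boolP (g \in msupp (x : tensG b F^o))) => [gx|/mcoeff_outdom //].
have [_ _ ind] := gdeg_grading (graded_end W0).
have := ind (msupp (x : tensG b F^o))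
  (fun g => frame_end (<< (x : tensG b F^o)@_g *g g >> : tensG b F^o)) _ _ g gx.
have h1 h : frame_end (<< (x : tensG b F^o)@_h *g h >> : tensG b F^o) \in gdeg (graded_end W0) h.
  by apply: frame_end_deg; exact: msuppU_le.
have h2 : \sum_(h <- msupp (x : tensG b F^o))
    frame_end (<< (x : tensG b F^o)@_h *g h >> : tensG b F^o) = 0.
  by rewrite -raddf_sum -[RHS]x0 /=; congr frame_end; exact/esym/monalgE.
move=> /(_ h1 h2) /(congr1 (fun f : graded_end W0 => (f : gendo W0) w0)).
rewrite frame_endU => /scale_alg_eq0; apply.
exact: bij_endo_neq0 (pd g) (frame_bij g fr) w00.
Qed.

Lemma frame_end_surj f : exists x, frame_end x = f.
Proof.
have [pd _ _] := fr.
move: f; apply: (grading_ind (gdeg_grading (graded_end W0)))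
  => [|_ _ [x <-] [y <-]|g f].
- by exists 0; rewrite raddf0.
- by exists (x + y); rewrite raddfD.
- move=> /gendo_degP/(endo_deg_uniq Ws (pd g) (frame_bij g fr))[c fE].
  exists (<< (c : F^o) *g g >> : tensG b F^o); apply: gendo_ext => w.
  by rewrite frame_endU fE.
Qed.

Lemma graded_end_of_frame : galg_iso (graded_end W0) T.
Proof.
apply: galg_iso_sym; exists (frame_end : {lrmorphism T -> graded_end W0}).
split; last exact: frame_end_deg.
exact: inj_surj_bij frame_end_inj frame_end_surj.
Qed.
End FrameIso.

End EndoFrames.

(** * Dependence of the frame on the equivariance class *)

(** Conjugate the frame by the bijection between the modules. *)
Lemma frame_transport (F : fieldType) (G : groupType) (W W' : gmodule F G) b phi :
  equivariant W W' -> endo_frame (W := W') b phi ->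
  exists phi', endo_frame (W := W) b phi'.
Proof.
move=> [psi [p [psib psid [k pK kp] pd]]] [fd f1 fM].
have pA (c : F) w : p (c%:A *: w) = c%:A *: p w.
  by rewrite linearZ /= linearZ /= rmorph1.
have kA (c : F) w : k (c%:A *: w) = c%:A *: k w.
  by apply: (can_inj pK); rewrite pA !kp.
exists (fun g w => k (phi g (p w))); split=> [g|w|g h w].
- have [pl pg] := fd g; split=> [x u v|h w wh].
    apply: (can_inj pK); rewrite kp linearP /= pl.
    by rewrite linearP /=; congr (_ *: _ + _); exact/esym/kp.
  apply: (graded_inv (V := restr W) (V' := restr W') (raddfD p) (mdeg_grading W)
    (mdeg_grading W') (can_inj pK) pd).
  suff: p (k (phi g (p w))) \in mdeg W' (h * g)%g by [].
  by rewrite kp; apply/pg/pd.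
- by rewrite f1 kA pK.
- by rewrite kp fM kA.
Qed.

(** * Twisting a frame by a cocycle *)

Section TwistedFrame.
Variables (F : fieldType) (G : groupType) (a : cocycle F G).
Variables (A : gradedAlg F G) (W : gradedMod A).
Local Notation aW := (alpha_mod a W).

(** Multiplying by v_k on the right is a product in the sense of tconv, for the
pairing (w, c) |-> c f(w); in this way the linearity over alpha(A) of the twisted
endomorphism is an instance of the associativity of tconv. *)
Definition twist_op (f : W -> W) (w : restr W) (c : F^o) : restr W :=
  (c : F)%:A *: f w.

Lemma alpha_actE (x : alpha_alg a A) (u : aW) :
  diag_val (x *: u) = tconv (@act_op F G A W) (diag_val x) (diag_val u).
Proof. by []. Qed.

Section TwistEndo.
Variables (k : G) (f : W -> W) (fk : endo_deg (W := W) k f).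

Let opDl w w' c : twist_op f (w + w') c = twist_op f w c + twist_op f w' c.
Proof.
have [fl _] := fk; rewrite /twist_op -scalerDr; congr (_ *: _).
by have := fl 1 w w'; rewrite !scale1r.
Qed.

Let opDr w c c' : twist_op f w (c + c') = twist_op f w c + twist_op f w c'.
Proof. by rewrite /twist_op scalerDl scalerDl. Qed.

(** The map v_h (x) w |-> v_h v_k (x) f(w). *)
Definition twist_val (u : aW) : tensG a (restr W) :=
  tconv (twist_op f) (diag_val u) (<< 1 *g k >> : tensG a F^o).

Lemma twist_valE u g : (twist_val u)@_g =
  (a (g * k^-1)%g k)%:A *: f (diag_val u)@_(g * k^-1)%g.
Proof.
rewrite /twist_val (tconvEw a opDl opDr (fsubset_refl _) msuppU_le) raddf_sum /=.
under eq_bigr => h _ do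
  rewrite big_seq_fset1 mcoeffUU /twist_op scale1r scale1r mcoeffU.
case: (boolP ((g * k^-1)%g \in msupp (diag_val u))) => [gu|gu].
  rewrite (big_fsetD1 _ gu) /= mulgVK eqxx mulr1n big1_fset ?addr0 // => h.
  rewrite in_fsetD1 => /andP[hg _] _.
  have /negbTE -> : (h * k)%g != g by apply: contra_neq hg => <-; rewrite mulgK.
  by rewrite mulr0n.
rewrite (mcoeff_outdom gu) (endo_deg0E fk) scaler0 big1_seq // => h /= hu.
have /negbTE -> : (h * k)%g != g.
  by apply: contraNneq gu => <-; rewrite mulgK.
by rewrite mulr0n.
Qed.

Lemma twist_subproof u : twist_val u \in diag a (mdeg_grading W).
Proof.
have [_ fd] := fk; apply/diagP => g; rewrite twist_valE.
have [sub _ _] := mdeg_grading W; have [s0 sl] := sub g.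
have /diagP ud : diag_val u \in diag a (mdeg_grading W) by case: u.
have := fd _ _ (ud (g * k^-1)%g); rewrite mulgVK => fu.
by have := sl (a (g * k^-1)%g k) _ _ fu s0; rewrite addr0.
Qed.

Definition twist_endo (u : aW) : aW := Diag (twist_subproof u).

Lemma twist_endo_deg : endo_deg (W := aW) k twist_endo.
Proof.
have [fl fd] := fk; split=> [x u v|h u uh].
  have valD (p q : aW) : twist_val (p + q) = twist_val p + twist_val q.
    exact: tconvDl.
  have valZ : twist_val (x *: u) = diag_val (x *: twist_endo u).
    rewrite alpha_actE /twist_val alpha_actE.
    have H := @tconvA F G a A (restr W) F^o (restr W) (restr W) (restr W)
      (@act_op F G A W) (twist_op f) (twist_op f) (@act_op F G A W).
    apply: H => //.
    - by move=> y y' w; exact: (scalerDl (w : W)).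
    - by move=> y w w'; exact: (scalerDr y (w : W)).
    - by move=> y y' w; exact: (scalerDl (w : W)).
    - by move=> y w w'; exact: (scalerDr y (w : W)).
    - move=> c w d; rewrite !restrZE /twist_op (endo_degZ _ _ fk).
      by rewrite !scale_algA mulrC.
    - by move=> c y w; rewrite !restrZE /act_op scale_algC.
    - by move=> y w d; rewrite /twist_op /act_op (endo_degZ _ _ fk) scale_algC.
  by apply: val_inj; rewrite -[LHS]/(twist_val _) valD valZ.
change (msupp (twist_val u) `<=` [fset (h * k)%g])%fset.
rewrite /twist_val (tconvEw a opDl opDr uh msuppU_le) !big_seq_fset1.
exact: msuppU_le.
Qed.
End TwistEndo.

Lemma alpha_scaleE (c : F) (u : aW) g :
  (diag_val (c%:A *: u))@_g = c%:A *: ((diag_val u)@_g : W).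
Proof.
have := alpha_restrZ c (u : restr (alpha_mod_type a W)).
rewrite restrZE => ->.
exact: (mcoeffZ_tens (a := a) c (diag_val u) g).
Qed.

Lemma alpha_ext (u v : aW) :
  (forall g, (diag_val u)@_g = (diag_val v)@_g) -> u = v.
Proof. by move=> uv; apply/val_inj/malgP. Qed.

Fact mul_cocycle_neq0 (b : cocycle F G) g h : a g h * b g h != 0.
Proof. by rewrite mulf_neq0 ?cocycle_neq0. Qed.

Fact mul_cocycleE (b : cocycle F G) g h k :
  (a g h * b g h) * (a (g * h)%g k * b (g * h)%g k) =
  (a g (h * k)%g * b g (h * k)%g) * (a h k * b h k).
Proof. by rewrite mulrACA !cocycleE mulrACA. Qed.

Definition mul_cocycle (b : cocycle F G) : cocycle F G :=
  Cocycle (mul_cocycle_neq0 b) (mul_cocycleE b).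

(** Composing the twisted maps of degrees g and h moves v_r to v_r v_g v_h, which
is a(g,h) v_r v_gh by the cocycle identity of a. *)
Lemma twist_frame b phi : endo_frame (W := W) b phi ->
  exists phi', endo_frame (W := aW) (mul_cocycle b) phi'.
Proof.
move=> [pd p1 pM]; exists (fun g => twist_endo (pd g)).
split=> [g|u|g h u]; first exact: twist_endo_deg.
  apply: alpha_ext => g.
  rewrite (twist_valE (pd 1%g)) alpha_scaleE p1 invg1 mulg1 scale_algA.
  by rewrite cocycleg1.
apply: alpha_ext => m.
rewrite alpha_scaleE (twist_valE (pd h)).
rewrite -[diag_val (twist_endo (pd g) u)]/(twist_val g (phi g) u).
rewrite -[diag_val (twist_endo (pd (g * h)%g) u)]/(twist_val (g * h)%g (phi (g * h)%g) u).
rewrite (twist_valE (pd g)) (twist_valE (pd (g * h)%g)).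
rewrite (endo_degZ _ _ (pd h)) pM !scale_algA invgM mulgA.
set r := (m / h / g)%g; congr (_%:A *: _).
have -> : (m / h)%g = (r * g)%g by rewrite /r mulgVK.
transitivity (a r g * a (r * g)%g h * b g h); first by ring.
by rewrite cocycleE /=; ring.
Qed.
End TwistedFrame.

(** * Comparison of a graded space with its twist *)

Section DiagTotal.
Variables (F : fieldType) (G : groupType) (a : cocycle F G).
Variables (V : lmodType F) (Vd : G -> {pred V}) (grV : is_grading Vd).
Local Notation D := (diag_type a grV).

Definition diag_total (u : D) : V := \sum_(g <- msupp (val u)) (val u)@_g.

Lemma diag_totalEw (d : {fset G}) (u : D) : (msupp (val u) `<=` d)%fset ->
  diag_total u = \sum_(g <- d) (val u)@_g.
Proof.
move=> ud; rewrite /diag_total (big_fset_incl _ ud) //= => g _ gu.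
exact: mcoeff_outdom.
Qed.

Fact diag_total_linear : linear diag_total.
Proof.
move=> c u v; set d := (msupp (val u) `|` msupp (val v))%fset.
rewrite (@diag_totalEw d u) ?fsubsetUl // (@diag_totalEw d v) ?fsubsetUr //.
rewrite (@diag_totalEw d); last first.
  apply: fsubset_trans (msuppD_le _ _) _.
  exact: fsetUSS (msuppZ_tens c (val u)) (fsubset_refl _).
rewrite scaler_sumr -big_split /=; apply: eq_bigr => g _.
by rewrite diag_valP.
Qed.

HB.instance Definition _ :=
  GRing.isLinear.Build F D V _ diag_total diag_total_linear.

Lemma diag_total_homog g u : u \in diag_deg (grV := grV) g ->
  diag_total u = (val u)@_g.
Proof. by move=> ug; rewrite (@diag_totalEw [fset g]%fset) // big_seq_fset1. Qed.

Lemma diag_total_deg g u : u \in diag_deg (grV := grV) g -> diag_total u \in Vd g.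
Proof. by move=> /diag_total_homog ->; have /diagP := valP u; apply. Qed.

(** The coefficients of u are the homogeneous components of its total. *)
Lemma diag_total_inj : injective diag_total.
Proof.
apply: raddf_inj => u u0; apply/val_inj/malgP => g; rewrite diag_val0.
have [_ _ ind] := grV.
case: (boolP (g \in msupp (val u))) => [gu|/mcoeff_outdom //].
by apply: (ind _ _ _ u0 _ gu) => h; have /diagP := valP u; apply.
Qed.

Lemma homog_subproof g v : v \in Vd g -> << v *g g >> \in diag a grV.
Proof.
move=> vg; apply/diagP => h; rewrite mcoeffU; case: eqP => [<-|_] //.
by rewrite mulr0n; have [sub _ _] := grV; case: (sub h).
Qed.

Definition homog g v (vg : v \in Vd g) : D := Diag (homog_subproof vg).

Lemma homog_deg g v (vg : v \in Vd g) : homog vg \in diag_deg (grV := grV) g.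
Proof. exact: msuppU_le. Qed.

Lemma diag_total_surj v : exists u, diag_total u = v.
Proof.
move: v; apply: (grading_ind grV) => [|_ _ [u <-] [v <-]|g v vg].
- by exists 0; rewrite raddf0.
- by exists (u + v); rewrite raddfD.
- by exists (homog vg); rewrite (diag_total_homog (homog_deg vg)) mcoeffUU.
Qed.
End DiagTotal.

(** * Simplicity of the twisted module *)

Section AlphaSimple.
Variables (F : fieldType) (G : groupType) (a : cocycle F G).
Variables (A : gradedAlg F G) (W : gradedMod A).
Local Notation aW := (alpha_mod a W).

Definition mod_total (u : aW) : W := diag_total (a := a) (grV := mdeg_grading W) u.

Lemma mod_totalD u v : mod_total (u + v) = mod_total u + mod_total v.
Proof. exact: (raddfD (@diag_total F G a _ _ (mdeg_grading W)) u v). Qed.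

Lemma mod_total0 : mod_total 0 = 0.
Proof. exact: (raddf0 (@diag_total F G a _ _ (mdeg_grading W))). Qed.

Lemma mod_total_inj : injective mod_total.
Proof. exact: diag_total_inj. Qed.

Lemma mod_totalZ (c : F) u : mod_total (c%:A *: u) = c%:A *: mod_total u.
Proof.
have := alpha_restrZ c (u : restr (alpha_mod_type a W)); rewrite restrZE => uE.
rewrite /mod_total uE.
exact: (linearZZ (@diag_total F G a _ _ (mdeg_grading W)) c u).
Qed.

Definition homog_alg g (x : A) (xg : x \in gdeg A g) : alpha_alg a A :=
  @homog F G a _ _ (gdeg_grading A) g x xg.

Lemma mod_total_homog g h x (xg : x \in gdeg A g) u : u \in mdeg aW h ->
  mod_total (homog_alg xg *: u) = (a g h)%:A *: (x *: mod_total u).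
Proof.
move=> uh; rewrite /mod_total (diag_total_homog uh).
have xuh := mdegM (g0 := aW) (@homog_deg F G a _ _ (gdeg_grading A) _ _ xg) uh.
rewrite (diag_total_homog xuh).
rewrite -[val _]/(tconv (@act_op F G A W) (<< x *g g >> : tensG a A) (val u)).
rewrite (tconvEw a _ _ msuppU_le uh).
- by rewrite !big_seq_fset1 !mcoeffUU.
- by move=> y y' w; exact: (scalerDl (w : W)).
- by move=> y w w'; exact: (scalerDr y (w : W)).
Qed.
Lemma mod_total_deg g u : u \in mdeg aW g -> mod_total u \in mdeg W g.
Proof. exact: diag_total_deg. Qed.

Lemma mod_total_deg_inv g u : mod_total u \in mdeg W g -> u \in mdeg aW g.
Proof.
apply: (graded_inv (V := restr aW) (V' := restr W) mod_totalD (mdeg_grading aW)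
  (mdeg_grading W) mod_total_inj mod_total_deg).
Qed.

Lemma mod_total_surj w : exists u, mod_total u = w.
Proof. exact: diag_total_surj. Qed.

Lemma mod_total_sum (s : seq G) (c : G -> aW) :
  mod_total (\sum_(g <- s) c g) = \sum_(g <- s) mod_total (c g).
Proof. exact: (big_morph _ mod_totalD mod_total0). Qed.

(** The action of a homogeneous x on W lifts to the twisted module, up to the
scalar a(g,h), which is invertible. *)
Lemma mod_total_act g h x (xg : x \in gdeg A g) u : u \in mdeg aW h ->
  mod_total ((a g h)^-1%:A *: (homog_alg xg *: u)) = x *: mod_total u.
Proof.
move=> uh; rewrite mod_totalZ (mod_total_homog xg uh).
by rewrite scale_algK ?cocycle_neq0.
Qed.

(** The totals of a graded submodule N form a graded submodule of W: it suffices
to act by homogeneous elements of A on homogeneous elements of N, where the two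
actions agree up to an invertible scalar. *)
Lemma alpha_simple_submod (N : {pred aW}) : abs_graded_simple W ->
  graded_submod N -> (forall u, u \in N -> u = 0) \/ (forall u, u \in N).
Proof.
move=> [_ Wsub _] [[N0 NZ] Nhom].
have ND u v : u \in N -> v \in N -> u + v \in N.
  by move=> uN vN; have := NZ 1 _ _ uN vN; rewrite scale1r.
have NS x u : u \in N -> x *: u \in N.
  by move=> uN; have := NZ x _ _ uN N0; rewrite addr0.
pose N' : {pred W} := fun w => `[< exists2 u, u \in N & mod_total u = w >].
have N'P w : reflect (exists2 u, u \in N & mod_total u = w) (w \in N').
  exact: asboolP.
have N'0 : 0 \in N' by apply/N'P; exists 0; rewrite ?mod_total0.
have N'D v w : v \in N' -> w \in N' -> v + w \in N'.
  move=> /N'P[u1 u1N <-] /N'P[u2 u2N <-]; apply/N'P.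
  by exists (u1 + u2); rewrite ?mod_totalD ?ND.
have N'sum (s : seq G) (c : G -> W) :
    (forall g, c g \in N') -> \sum_(g <- s) c g \in N'.
  by move=> cN; apply: (big_ind (fun w => w \in N')).
have N'Z x u : u \in N -> x *: mod_total u \in N'.
  move=> uN; move: x; apply: (grading_ind (gdeg_grading A)) => [|x y xN yN|g x xg].
  - by rewrite scale0r.
  - by rewrite scalerDl; exact: N'D.
  - have [s [c [cN ->]]] := Nhom u uN.
    rewrite mod_total_sum scaler_sumr; apply: N'sum => h; apply/N'P.
    exists ((a g h)^-1%:A *: (homog_alg xg *: c h)); first exact/NS/NS/(cN h).1.
    exact: mod_total_act (cN h).2.
have [|N'00|N'1] := Wsub N'.
- split; first split=> // [x v w /N'P[u uN <-]].
    by apply: N'D; exact: N'Z.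
  move=> w /N'P[u uN <-]; have [s [c [cN ->]]] := Nhom u uN.
  exists s, (fun g => mod_total (c g)); split; last exact: mod_total_sum.
  move=> g; split; last exact/mod_total_deg/(cN g).2.
  by apply/N'P; exists (c g) => //; exact: (cN g).1.
- left=> u uN; apply: mod_total_inj; rewrite mod_total0; apply: N'00.
  by apply/N'P; exists u.
- right=> u; have /N'P[v vN /mod_total_inj <-//] := N'1 (mod_total u).
Qed.

(** Transported to W along the total, f is still A-linear: f preserves degrees,
so the same scalar a(g,h) appears before and after applying f. *)
Lemma alpha_simple_end (f : {linear aW -> aW}) : abs_graded_simple W ->
  (forall g u, u \in mdeg aW g -> f u \in mdeg aW g) ->
  exists c : F, forall u, f u = c%:A *: u.
Proof.
move=> [_ _ Wend] fd.
have /choice[t tK] := mod_total_surj.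
have Kt u : t (mod_total u) = u by apply: mod_total_inj; rewrite tK.
pose f' w := mod_total (f (t w)).
have td g w : w \in mdeg W g -> t w \in mdeg aW g.
  by move=> wg; apply: mod_total_deg_inv; rewrite tK.
have f'D v w : f' (v + w) = f' v + f' w.
  rewrite /f' -mod_totalD -raddfD; congr (mod_total (f _)).
  by apply: mod_total_inj; rewrite mod_totalD !tK.
have f'Z x w : f' (x *: w) = x *: f' w.
  have f'0 : f' 0 = 0 by apply: (addrI (f' 0)); rewrite -f'D !addr0.
  move: x; apply: (grading_ind (gdeg_grading A)) => [|x y xN yN|g x xg].
  - by rewrite !scale0r.
  - by rewrite !scalerDl f'D xN yN.
  move: w; apply: (grading_ind (V := restr W) (mdeg_grading W))
    => [|v w vN wN|h w wh].
  - by rewrite f'0 scaler0 f'0.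
  - by rewrite scalerDr !f'D scalerDr vN wN.
  have twh := td _ _ wh.
  rewrite /f' -(mod_total_act xg (fd _ _ twh)) -2!linearZZ; congr (mod_total (f _)).
  by apply: mod_total_inj; rewrite (mod_total_act xg twh) !tK.
have f'l : linear f' by move=> x v w; rewrite f'D f'Z.
pose f'' : {linear W -> W} := HB.pack f' (GRing.isLinear.Build A W W _ f' f'l).
have [g w wg|c cE] := Wend f''; first exact/mod_total_deg/fd/td.
exists c => u; apply: mod_total_inj; rewrite mod_totalZ -(cE (mod_total u)).
by rewrite /= /f' Kt.
Qed.

Lemma alpha_simple : abs_graded_simple W -> abs_graded_simple aW.
Proof.
move=> Ws; split; first 1 last.
- by move=> N; exact: alpha_simple_submod.
- by move=> f; exact: alpha_simple_end.
have [[w w0] _ _] := Ws; have [u uw] := mod_total_surj w.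
by exists u; apply: contra_neq w0 => u0; rewrite -uw u0 mod_total0.
Qed.

End AlphaSimple.

(** Each phi g is an isomorphism from W to its suspension by g. *)
Lemma frame_invariant (F : fieldType) (G : groupType) (A : gradedAlg F G)
    (W : gradedMod A) b phi :
  endo_frame (W := W) b phi -> G_invariant W.
Proof.
move=> fr g; have [/(_ g)[pl pd] _ _] := fr.
pose p : {linear W -> suspension W g} := HB.pack (phi g)
  (GRing.isLinear.Build A W (suspension W g) _ (phi g) pl).
by exists p; split; [exact: frame_bij fr|exact: pd].
Qed.

(** The total embeds alpha(A) in A and alpha(W) in W, which bounds cardinals. *)
Lemma alpha_irr (F : fieldType) (G : groupType) KA KM (a : cocycle F G)
    (W : gmodule F G) :
  irr_inv KA KM W -> irr_inv KA KM (alpha a W).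
Proof.
move=> [[fA fAI] [fM fMI] Winv Ws]; split; last exact: alpha_simple.
- exists (fA \o @diag_total F G a _ _ (gdeg_grading (gm_alg W))).
  by apply: inj_comp fAI _; exact: diag_total_inj.
- by exists (fM \o @mod_total F G a _ W); apply: inj_comp fMI _; exact: mod_total_inj.
- have [b [phi /(twist_frame a)[phi' fr]]] := frame_exists Winv Ws.
  exact: frame_invariant fr.
Qed.

(** * The invariant omega in terms of frames *)

Lemma equivariant_refl (F : fieldType) (G : groupType) (W : gmodule F G) :
  equivariant W W.
Proof.
pose psi : {lrmorphism gm_alg W -> gm_alg W} := idfun.
have pl : linear_for (psi \; *:%R) (fun w : W => w) by [].
pose phi : {linear W -> W | psi \; *:%R} := HB.pack (fun w : W => w)
  (GRing.isLinear.Build _ W W _ (fun w : W => w) pl).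
by exists psi, phi; split=> //; exists id.
Qed.

(** Any other representative W' of the class, with End^r(G)(W') isomorphic to
F^b' G, gives W a second frame with cocycle b', and then b' is cohomologous
to b. *)
Lemma omega_frame (F : fieldType) (G : groupType) KA KM (W : gmodule F G)
    (h : irr_inv KA KM W) b phi :
  endo_frame (W := W) b phi -> omega (class_of_irr h) = H2_class b.
Proof.
move=> fr; have [_ _ _ Ws] := h; have [W0 _ _] := Ws.
rewrite /omega; case: xgetP => [_ -> [W' [W'0 [b' [[_ WW'] <- iso]]]]|].
  have [phi1 fr1] := frame_of_graded_end iso.
  have [phi2 fr2] := frame_transport WW' fr1.
  exact/H2_classP/(frame_cohomologous Ws fr2 fr).
move=> /(_ (H2_class b)) []; exists W, W0, b; split=> //.
  by split=> //; exact: equivariant_refl.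
exact: graded_end_of_frame Ws fr.
Qed.

Section QuotientCocycle.
Variables (F : fieldType) (G : groupType) (w b : cocycle F G).

Fact div_cocycle_neq0 g h : w g h / b g h != 0.
Proof. by rewrite mulf_neq0 ?invr_eq0 ?cocycle_neq0. Qed.

Fact div_cocycleE g h k :
  (w g h / b g h) * (w (g * h)%g k / b (g * h)%g k) =
  (w g (h * k)%g / b g (h * k)%g) * (w h k / b h k).
Proof. by rewrite mulrACA -invfM !cocycleE invfM mulrACA. Qed.

Definition div_cocycle : cocycle F G := Cocycle div_cocycle_neq0 div_cocycleE.

Lemma mul_div_cocycle : H2_class (mul_cocycle div_cocycle b) = H2_class w.
Proof.
apply/H2_classP; exists (fun=> 1) => [g|g h]; first exact: oner_neq0.
by rewrite invr1 !mul1r /= divfK ?cocycle_neq0.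
Qed.
End QuotientCocycle.

(** * The regular module of a twisted group algebra *)

Section RegularModule.
Variables (F : fieldType) (G : groupType) (A : gradedAlg F G).

Definition regular_deg (g : G) : {pred restr (A^o : lmodType A)} := gdeg A g.

Fact regular_grading : is_grading regular_deg.
Proof.
have [sub span ind] := gdeg_grading A.
split=> [g||]; [|exact: span|exact: ind].
have [s0 sl] := sub g; split=> [|c v w vg wg]; first exact: s0.
have -> : c *: v + w = c *: (v : A) + (w : A) by rewrite -[c *: (v : A)]mulr_algl.
exact: sl.
Qed.

Fact regular_degM g h (x : A) (w : A^o) :
  x \in gdeg A g -> w \in regular_deg h -> x *: w \in regular_deg (g * h)%g.
Proof. exact: gdegM. Qed.

Definition regular_mod : gradedMod A :=
  @GradedMod F G A (A^o : lmodType A) _ regular_grading regular_degM.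
End RegularModule.

Section TwistedRegular.
Variables (F : fieldType) (G : groupType) (b : cocycle F G).
Local Notation T := (twisted_group_alg b).

Lemma twisted_homogE g (x : T) : x \in gdeg T g ->
  x = (x : tensG b F^o)@_g *: twisted_basis b g.
Proof.
move=> /twisted_degP xg; apply/malgP => h.
rewrite (mcoeffZ_tens (a := b)) mcoeffU -[_ *: _]/(_ * _).
by case: eqVneq => [<-|gh]; rewrite ?mulr1 // mulr0n mulr0 xg // eq_sym.
Qed.

Lemma regular_frame : endo_frame (W := regular_mod T) b (fun g (w : T) => w * twisted_basis b g).
Proof.
split=> [g|w|g h w].
- split=> [x u v|h w wh]; first by rewrite mulrDl -[x *: u]/(x * u) -mulrA.
  by apply: (gdegM (g0 := T) wh); exact: twisted_basis_deg.
- by rewrite twisted_basis1 -scalerAr mulr1; exact: (esym (mulr_algl (b 1%g 1%g) (w : T))).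
- by rewrite -mulrA twisted_basisM -scalerAr; exact: (esym (mulr_algl (b g h) _)).
Qed.

(** A non-zero homogeneous element of F^b G is a multiple of some v_g, hence a
unit: so a non-zero graded submodule contains 1, and a degree-preserving
endomorphism is right multiplication by an element of the line F 1. *)
Lemma regular_simple : abs_graded_simple (regular_mod T).
Proof.
split.
- by exists (1 : T); exact: oner_neq0.
- move=> N [[N0 NZ] Nhom].
  have [NE|/existsNP[u /not_implyP[uN u0]]] := pselect (forall u, u \in N -> u = 0).
    by left.
  right=> w; have [s [c [cN uE]]] := Nhom u uN.
  have [g cg0] : exists g, c g <> 0.
    apply: contrapT => /forallNP c0; apply: u0; rewrite uE big1 // => g _.
    exact: contrapT (c0 g).
  have [cgN /twisted_homogE cgE] := cN g.
  set x := (c g : tensG b F^o)@_g in cgE.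
  have x0 : x != 0 by apply/eqP => x0; apply: cg0; rewrite cgE x0 scale0r.
  pose y : T := (x * b g^-1%g g * b 1%g 1%g)^-1 *: twisted_basis b g^-1%g.
  have yE : y * (c g : T) = 1.
    rewrite cgE /y -scalerAl -scalerAr twisted_basisM mulVg twisted_basis1 !scalerA.
    rewrite -!mulrA mulVf ?scale1r // !mulf_neq0 ?cocycle_neq0 //.
  have := NZ (w * y) _ _ cgN N0; rewrite addr0 /= -[_ *: _]/(w * y * (c g : T)).
  by rewrite -mulrA yE mulr1.
- move=> f fd.
  have /twisted_homogE f1 : f (1 : T) \in gdeg T 1%g by apply: fd; exact: gdeg1.
  set c := (f 1 : tensG b F^o)@_1%g in f1.
  exists (c * b 1%g 1%g) => w.
  have -> : f w = (w : T) * f (1 : T).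
    by rewrite -[RHS]linearZZ; congr (f _); exact/esym/mulr1.
  rewrite f1 twisted_basis1 scalerA -scalerAr mulr1; exact: (esym (mulr_algl _ (w : T))).
Qed.

(** A finitely supported function is coded by the sequence of its coded pairs of
argument and value. *)
Lemma twisted_embeds (K : Type) : infinite_bound F G K ->
  exists f : T -> K, injective f.
Proof.
move=> [[i iI] [iF iFI] [iG iGI]].
have [c cI] := @seq_embeds {classic K} i iI.
pose e (f : tensG b F^o) (g : G) : K := c [:: iG g; iF f@_g].
exists (fun f : tensG b F^o => c [seq e f g | g <- msupp f]) => f k.
move=> /cI fk; have {}fk : [seq (g, f@_g) | g <- msupp f] = [seq (g, k@_g) | g <- msupp k].
  pose d p : K := c [:: iG p.1; iF p.2].
  have dI : injective d by move=> [g x] [h y] /cI[/iGI -> /iFI ->].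
  by apply: (inj_map dI); rewrite -!map_comp.
have fk1 : (msupp f : seq G) = msupp k.
  have := congr1 (map fst) fk; rewrite -!map_comp.
  by rewrite !map_id.
apply/malgP => g; case: (boolP (g \in msupp f)) => gf.
  have : (g, f@_g) \in [seq (g, k@_g) | g <- msupp k].
    by rewrite -fk; apply/mapP; exists g.
  by move=> /mapP[h _ [-> ->]].
have gk : g \notin msupp k.
  by move: gf; rewrite -[g \in _]/(g \in (msupp f : seq G)) fk1.
by rewrite !mcoeff_outdom.
Qed.

Lemma regular_irr (KA KM : Type) : infinite_bound F G KA -> infinite_bound F G KM ->
  irr_inv KA KM (GModule (regular_mod T)).
Proof.
move=> hKA hKM; split; [exact: twisted_embeds|exact: twisted_embeds| |].
  exact: frame_invariant regular_frame.
exact: regular_simple.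
Qed.
End TwistedRegular.

Theorem theorem5p17 (F : fieldType) (G : groupType) (KA KM : Type)
    (hKA : infinite_bound F G KA) (hKM : infinite_bound F G KM) :
  (forall (W : gmodule F G), irr_inv KA KM W ->
     forall w : H2 F G,
     exists (a : cocycle F G) (h : irr_inv KA KM (alpha a W)),
       omega (class_of_irr h) = w) /\
  (forall w : H2 F G, exists c : Irr_inv F G KA KM, omega c = w).
Proof.
have twist (W : gmodule F G) : irr_inv KA KM W -> forall w : H2 F G,
    exists (a : cocycle F G) (h : irr_inv KA KM (alpha a W)),
      omega (class_of_irr h) = w.
  move=> hW w; have [_ _ Winv Ws] := hW.
  have [b [phi fr]] := frame_exists Winv Ws.
  have [phi' fr'] := twist_frame (div_cocycle (repr w) b) fr.
  exists (div_cocycle (repr w) b), (alpha_irr _ hW).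
  apply: (etrans (omega_frame (W := alpha _ W) _ fr')).
  by rewrite mul_div_cocycle; exact: reprK.
split=> // w.
have [a [h hw]] := twist _ (regular_irr (trivial_cocycle F G) hKA hKM) w.
by exists (class_of_irr h).
Qed.
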